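(* Let $\Bbbk$ be a field of characteristic zero and $n\geq 1$ an integer. Let $\overline{\Gamma}_n$ be the quiver with vertices $\{1,2\}$ and arrows $\{a_i,b_i\mid 1\leq i\leq n\}$ such that $a_i=e_2a_ie_1$ and $b_i=e_1b_ie_2$. Let $B=\Bbbk e_1\oplus\Bbbk e_2$, let $\Bbbk\overline{\Gamma}_n$ be the path algebra of $\overline{\Gamma}_n$ (a $B$-algebra), and let $\mathcal{B}(\Gamma_n)$ denote $\Bbbk\overline{\Gamma}_n$ with the two $(2n)$-th Euler continuants $(a_1,b_1,\dots,a_n,b_n)$ and $(b_n,a_n,\dots,b_1,a_1)$ inverted. Let $\{\!\!\{-,-\}\!\!\}$ be the $B$-linear double bracket on $\mathcal{B}(\Gamma_n)$ determined, for $i,j\in\{1,\dots,n\}$, by $$\{\!\!\{a_i,a_j\}\!\!\}=\begin{cases}-\frac12(a_i\otimes a_j+a_j\otimes a_i)& i<j\\ 0& i=j\\ \frac12(a_i\otimes a_j+a_j\otimes a_i)& i>j\end{cases},\qquad \{\!\!\{b_i,b_j\}\!\!\}=\begin{cases}-\frac12(b_i\otimes b_j+b_j\otimes b_i)& i<j\\ 0& i=j\\ \frac12(b_i\otimes b_j+b_j\otimes b_i)& i>j\end{cases},$$ $$\{\!\!\{a_i,b_j\}\!\!\}=\begin{cases}\frac12(e_1\otimes a_ib_j+b_ja_i\otimes e_2)& i<j\\ \frac12(b_ia_i\otimes e_2+e_1\otimes a_ib_i)+e_1\otimes e_2& i=j\\ -\frac12(b_ja_i\otimes e_2+e_1\otimes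 a_ib_j)-\delta_{i-j,1}\,(e_1\otimes e_2)& i>j\end{cases},$$ $$\{\!\!\{b_i,a_j\}\!\!\}=\begin{cases}\frac12(e_2\otimes b_ia_j+a_jb_i\otimes e_1)+\delta_{j-i,1}\,(e_2\otimes e_1)& i<j\\ -\frac12(e_2\otimes b_ia_i+a_ib_i\otimes e_1)-e_2\otimes e_1& i=j\\ -\frac12(a_jb_i\otimes e_1+e_2\otimes b_ia_j)& i>j\end{cases}.$$ Set $$\Phi:=(a_1,b_1,\dots,a_n,b_n)+(b_n,a_n,\dots,b_1,a_1)^{-1}\in\mathcal{B}(\Gamma_n).$$ Then the triple $\big(\mathcal{B}(\Gamma_n),\{\!\!\{-,-\}\!\!\},\Phi\big)$ is a Hamiltonian double quasi-Poisson algebra.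
   Context: $\otimes=\otimes_{\Bbbk}$. Quiver and path algebra: $\Bbbk\overline{\Gamma}_n$ is generated by orthogonal idempotents $e_1,e_2$ with $e_1+e_2=1$ and by $a_i=e_2a_ie_1$ (arrows $1\to2$), $b_i=e_1b_ie_2$ (arrows $2\to1$); paths are read from right to left. Euler continuants: for a sequence $y_1,\dots,y_k$ alternating between letters from $\{a_i\}$ and letters from $\{b_i\}$, put $(a_i)=a_i$, $(b_i)=b_i$, $(a_i,b_j)=e_2+a_ib_j$, $(b_i,a_j)=e_1+b_ia_j$, and $(y_1,\dots,y_k)=(y_1,\dots,y_{k-1})y_k+(y_1,\dots,y_{k-2})$ for $k\ge3$. Inverting: inverting $x\in e_sAe_s$ means adjoining $x^{-1}=e_sx^{-1}e_s$ with $xx^{-1}=x^{-1}x=e_s$. Double brackets: on an algebra $A$ over $B=\oplus_{s\in I}\Bbbk e_s$ ($1=\sum_{s\in I} e_s$ a finite decomposition into orthogonal idempotents), a $B$-linear double bracket is a $\Bbbk$-bilinear map $\{\!\!\{-,-\}\!\!\}:A\times A\to A\otimes A$ with $\{\!\!\{a,b\}\!\!\}=-\tau_{(12)}\{\!\!\{b,a\}\!\!\}$ ($\tau_{(12)}$ swaps factors), $\{\!\!\{a,bc\}\!\!\}=\{\!\!\{a,b\}\!\!\}c+b\{\!\!\{a,c\}\!\!\}$ for the outer bimodule structure $x(a'\otimes a'')y=xa'\otimes a''y$, and $\{\!\!\{-,e\}\!\!\}=0$ for $e\in B$. It is determined by its values on generators, with $\{\!\!\{c,x^{-1}\}\!\!\}=-x^{-1}\{\!\!\{c,x\}\!\!\}x^{-1}$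 for inverted elements. Triple bracket: with $\{\!\!\{a,b\otimes c\}\!\!\}_L:=\{\!\!\{a,b\}\!\!\}\otimes c$, $\tau_{(123)}(x_1\otimes x_2\otimes x_3)=x_3\otimes x_1\otimes x_2$ and $\tau_{(132)}(x_1\otimes x_2\otimes x_3)=x_2\otimes x_3\otimes x_1$, set $\{\!\!\{a,b,c\}\!\!\}=\{\!\!\{a,\{\!\!\{b,c\}\!\!\}\}\!\!\}_L+\tau_{(123)}\{\!\!\{b,\{\!\!\{c,a\}\!\!\}\}\!\!\}_L+\tau_{(132)}\{\!\!\{c,\{\!\!\{a,b\}\!\!\}\}\!\!\}_L$. The double bracket is quasi-Poisson if for all $a,b,c\in A$ $$\{\!\!\{a,b,c\}\!\!\}=\tfrac14\sum_{s\in I}\big(ce_sa\otimes e_sb\otimes e_s-ce_sa\otimes e_s\otimes be_s-ce_s\otimes ae_sb\otimes e_s+ce_s\otimes ae_s\otimes be_s-e_sa\otimes e_sb\otimes e_sc+e_sa\otimes e_s\otimes be_sc+e_s\otimes ae_sb\otimes e_sc-e_s\otimes ae_s\otimes be_sc\big).$$ A multiplicative moment map is an invertible $\Phi=\sum_{s\in I}\Phi_s$ with $\Phi_s\in e_sAe_s$ and, for all $a\in A$, $s\in I$, $\{\!\!\{\Phi_s,a\}\!\!\}=\frac12(ae_s\otimes\Phi_s-e_s\otimes\Phi_sa+a\Phi_s\otimes e_s-\Phi_s\otimes e_sa)$. A Hamiltonian double quasi-Poisson algebra is a triple $(A,\{\!\!\{-,-\}\!\!\},\Phi)$ with $\{\!\!\{-,-\}\!\!\}$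 a quasi-Poisson $B$-linear double bracket and $\Phi$ a multiplicative moment map. *)

(* Defs.v *)
From HB Require Import structures.
From mathcomp Require Import all_boot all_algebra.
From mathcomp Require Import boolp.
From mathcomp Require Import finmap monalg.

Set Implicit Arguments.
Unset Strict Implicit.
Unset Printing Implicit Defensive.

Import GRing.Theory.
Local Open Scope ring_scope.
Local Open Scope quotient_scope.

Section LinearQuotient.
Variables (k : pzRingType) (V : lmodType k) (S : V -> Prop).

Inductive span : V -> Prop :=
| span0 : span 0
| spanS c x y : S x -> span y -> span (c *: x + y).

Lemma spanD x y : span x -> span y -> span (x + y).
Proof.
by elim=> [|c u v Su _ IH] Sy; rewrite ?add0r// -addrA; apply: spanS; auto.
Qed.

Lemma spanZ c x : span x -> span (c *: x).
Proof.
elim=> [|d u v Su _ IH]; rewrite ?scaler0; first exact: span0.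
by rewrite scalerDr scalerA; apply: spanS.
Qed.

Lemma spanN x : span x -> span (- x).
Proof. by rewrite -scaleN1r; apply: spanZ. Qed.

Lemma span_gen x : S x -> span x.
Proof.
by move=> Sx; rewrite -[x]addr0 -[x]scale1r; apply: spanS => //; apply: span0.
Qed.

Definition span_eqv (x y : V) : bool := `[< span (x - y) >].

Lemma span_eqv_equiv : equiv_class_of span_eqv.
Proof.
split=> [x|x y|y x z]; first by apply/asboolP; rewrite subrr; exact: span0.
  by apply/asboolP/asboolP => /spanN; rewrite opprB.
move=> /asboolP xy /asboolP yz; apply/asboolP.
by have := spanD xy yz; rewrite addrA subrK.
Qed.

Canonical span_eqv_equiv_rel := EquivRelPack span_eqv_equiv.

Definition linquot := {eq_quot span_eqv_equiv_rel}.

HB.instance Definition _ := Choice.on linquot.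
HB.instance Definition _ := Quotient.on linquot.
HB.instance Definition _ := EqQuotient.on linquot.

Definition lqpi (x : V) : linquot := \pi_linquot x.
Definition lqrepr (u : linquot) : V := repr u.

Lemma lqreprK u : lqpi (lqrepr u) = u.
Proof. exact: reprK. Qed.

Lemma lqpiP x y : lqpi x = lqpi y <-> span (x - y).
Proof.
split; first by move/eqquotP/asboolP.
by move=> h; apply/eqquotP/asboolP.
Qed.

Lemma lqrepr_pi x : span (lqrepr (lqpi x) - x).
Proof. by apply/lqpiP; rewrite lqreprK. Qed.

Definition lqadd (u v : linquot) := lqpi (lqrepr u + lqrepr v).
Definition lqopp (u : linquot) := lqpi (- lqrepr u).
Definition lqscale (c : k) (u : linquot) := lqpi (c *: lqrepr u).

Lemma lqaddE x y : lqadd (lqpi x) (lqpi y) = lqpi (x + y).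
Proof.
by apply/lqpiP; rewrite opprD addrACA; apply: spanD; apply: lqrepr_pi.
Qed.

Lemma lqoppE x : lqopp (lqpi x) = lqpi (- x).
Proof. by apply/lqpiP; rewrite -opprD; apply/spanN/lqrepr_pi. Qed.

Lemma lqscaleE c x : lqscale c (lqpi x) = lqpi (c *: x).
Proof. by apply/lqpiP; rewrite -scalerBr; apply/spanZ/lqrepr_pi. Qed.

Lemma lqind (P : linquot -> Prop) : (forall x, P (lqpi x)) -> forall u, P u.
Proof. by move=> h u; rewrite -(lqreprK u). Qed.

Fact lqaddA : associative lqadd.
Proof.
by elim/lqind=> x; elim/lqind=> y; elim/lqind=> z; rewrite !lqaddE addrA.
Qed.
Fact lqaddC : commutative lqadd.
Proof. by elim/lqind=> x; elim/lqind=> y; rewrite !lqaddE addrC. Qed.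
Fact lqadd0 : left_id (lqpi 0) lqadd.
Proof. by elim/lqind=> x; rewrite lqaddE add0r. Qed.
Fact lqaddN : left_inverse (lqpi 0) lqopp lqadd.
Proof. by elim/lqind=> x; rewrite lqoppE lqaddE addNr. Qed.

HB.instance Definition _ :=
  GRing.isZmodule.Build linquot lqaddA lqaddC lqadd0 lqaddN.

Fact lqscaleA c d u : lqscale c (lqscale d u) = lqscale (c * d) u.
Proof. by elim/lqind: u => x; rewrite !lqscaleE scalerA. Qed.
Fact lqscale1 : left_id 1 lqscale.
Proof. by elim/lqind=> x; rewrite lqscaleE scale1r. Qed.
Fact lqscaleDr : right_distributive lqscale +%R.
Proof.
move=> c; elim/lqind=> x; elim/lqind=> y.
by rewrite /GRing.add /= !(lqaddE, lqscaleE) scalerDr.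
Qed.
Fact lqscaleDl u : {morph lqscale^~ u : c d / c + d}.
Proof.
elim/lqind: u => x c d.
by rewrite [RHS]/GRing.add /= !(lqaddE, lqscaleE) scalerDl.
Qed.

HB.instance Definition _ := GRing.Zmodule_isLmodule.Build k linquot
  lqscaleA lqscale1 lqscaleDr lqscaleDl.

Fact lqpi_linear : linear lqpi.
Proof.
by move=> c x y; rewrite /GRing.add /GRing.scale /= lqscaleE lqaddE.
Qed.

HB.instance Definition _ := GRing.isLinear.Build k V linquot *:%R lqpi lqpi_linear.

End LinearQuotient.

#[global] Opaque lqpi lqrepr lqadd lqopp lqscale.

Section AlgebraQuotient.
Variables (k : pzRingType) (A : algType k) (R : A -> Prop).

(* The two-sided ideal generated by R is the span of the elements x * r * y
   with r in R. *)
Definition ideal_gen (z : A) : Prop := exists x r y, R r /\ z = x * r * y.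

(* The quotient may be the zero ring, hence it is only a pzRingType here. *)
Definition algquot := linquot ideal_gen.

HB.instance Definition _ := GRing.Lmodule.on algquot.

Definition aqpi (x : A) : algquot := lqpi ideal_gen x.

HB.instance Definition _ :=
  GRing.isLinear.Build k A algquot *:%R aqpi (@lqpi_linear k A ideal_gen).

Lemma ideal_span_mull a x : span ideal_gen x -> span ideal_gen (a * x).
Proof.
elim=> [|c u v [b [r [d [Rr ->]]]] _ IH]; first by rewrite mulr0; exact: span0.
rewrite mulrDr -scalerAr; apply: spanS => //.
by exists (a * b), r, d; rewrite !mulrA.
Qed.

Lemma ideal_span_mulr a x : span ideal_gen x -> span ideal_gen (x * a).
Proof.
elim=> [|c u v [b [r [d [Rr ->]]]] _ IH]; first by rewrite mul0r; exact: span0.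
rewrite mulrDl -scalerAl; apply: spanS => //.
by exists b, r, (d * a); rewrite !mulrA.
Qed.

Definition aqmul (u v : algquot) : algquot := aqpi (lqrepr u * lqrepr v).

Lemma aqmulE x y : aqmul (aqpi x) (aqpi y) = aqpi (x * y).
Proof.
apply/lqpiP; set x' := lqrepr _; set y' := lqrepr _.
have -> : x' * y' - x * y = (x' - x) * y' + x * (y' - y).
  by rewrite mulrBl mulrBr addrA subrK.
apply: spanD; first by apply: ideal_span_mulr; apply: lqrepr_pi.
by apply: ideal_span_mull; apply: lqrepr_pi.
Qed.

Lemma aqind (P : algquot -> Prop) : (forall x, P (aqpi x)) -> forall u, P u.
Proof. exact: lqind. Qed.

Lemma aqpi_rel r : R r -> aqpi r = 0.
Proof.
move=> Rr; apply/lqpiP; rewrite subr0; apply: span_gen.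
by exists 1, r, 1; rewrite mul1r mulr1.
Qed.

Fact aqmulA : associative aqmul.
Proof.
by elim/aqind=> x; elim/aqind=> y; elim/aqind=> z; rewrite !aqmulE mulrA.
Qed.
Fact aqmul1l : left_id (aqpi 1) aqmul.
Proof. by elim/aqind=> x; rewrite aqmulE mul1r. Qed.
Fact aqmul1r : right_id (aqpi 1) aqmul.
Proof. by elim/aqind=> x; rewrite aqmulE mulr1. Qed.
Fact aqmulDl : left_distributive aqmul +%R.
Proof.
elim/aqind=> x; elim/aqind=> y; elim/aqind=> z.
by rewrite -linearD !aqmulE -linearD mulrDl.
Qed.
Fact aqmulDr : right_distributive aqmul +%R.
Proof.
elim/aqind=> x; elim/aqind=> y; elim/aqind=> z.
by rewrite -linearD !aqmulE -linearD mulrDr.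
Qed.

HB.instance Definition _ := GRing.Zmodule_isPzRing.Build algquot
  aqmulA aqmul1l aqmul1r aqmulDl aqmulDr.

Lemma aqpiM x y : aqpi (x * y) = aqpi x * aqpi y.
Proof. by rewrite [RHS]/GRing.mul /= aqmulE. Qed.

Lemma aqpi1 : aqpi 1 = 1. Proof. by []. Qed.

HB.instance Definition _ :=
  GRing.isMonoidMorphism.Build A algquot aqpi (conj aqpi1 aqpiM).

Lemma aq_scalerAl (c : k) (x y : algquot) : c *: (x * y) = (c *: x) * y.
Proof.
elim/aqind: x => x; elim/aqind: y => y.
by rewrite -aqpiM -!linearZ -aqpiM /= scalerAl.
Qed.

Lemma aq_scalerAr (c : k) (x y : algquot) : c *: (x * y) = x * (c *: y).
Proof.
elim/aqind: x => x; elim/aqind: y => y.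
by rewrite -aqpiM -!linearZ -aqpiM /= scalerAr.
Qed.

End AlgebraQuotient.

Section Character.
Variable k : fieldType.

Definition is_character (A : algType k) (chi : A -> k) : Prop :=
  [/\ forall c x y, chi (c *: x + y) = c * chi x + chi y,
      forall x y, chi (x * y) = chi x * chi y
    & chi 1 = 1].

Lemma characterD (A : algType k) (chi : A -> k) :
  is_character chi -> {morph chi : x y / x + y}.
Proof. by case=> chiL _ _ x y; rewrite -[x]scale1r chiL mul1r scale1r. Qed.

Lemma characterB (A : algType k) (chi : A -> k) :
  is_character chi -> {morph chi : x y / x - y}.
Proof.
by case=> chiL _ _ x y; rewrite addrC -scaleN1r chiL mulN1r addrC.
Qed.

Lemma character0 (A : algType k) (chi : A -> k) : is_character chi -> chi 0 = 0.
Proof. by move=> /characterB chiB; rewrite -(subrr 0) chiB subrr. Qed.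

Variables (A : algType k) (R : A -> Prop) (chi : A -> k).
Hypothesis chi_char : is_character chi.
Hypothesis chi_rel : forall r, R r -> chi r = 0.

Definition aqchar (u : algquot R) : k := chi (lqrepr u).

Let chiL c x y : chi (c *: x + y) = c * chi x + chi y.
Proof. by case: chi_char. Qed.
Let chiM x y : chi (x * y) = chi x * chi y.
Proof. by case: chi_char. Qed.
Let chi1 : chi 1 = 1.
Proof. by case: chi_char. Qed.
Let chi0 : chi 0 = 0 := character0 chi_char.

Lemma aqchar_pi x : aqchar (aqpi R x) = chi x.
Proof.
have h z : span (ideal_gen R) z -> chi z = 0.
  elim=> [//|c u v [a [r [b [Rr ->]]]] _ IH].
  by rewrite chiL IH !chiM (chi_rel Rr) mulr0 mul0r mulr0 addr0.
have /eqP := h _ (lqrepr_pi (ideal_gen R) x).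
by rewrite characterB // subr_eq0 => /eqP.
Qed.

Lemma aqcharL c x y : aqchar (c *: x + y) = c * aqchar x + aqchar y.
Proof.
elim/aqind: x => x; elim/aqind: y => y.
by rewrite -linearP !aqchar_pi chiL.
Qed.

Lemma aqcharM x y : aqchar (x * y) = aqchar x * aqchar y.
Proof.
elim/aqind: x => x; elim/aqind: y => y.
by rewrite -aqpiM !aqchar_pi chiM.
Qed.

Lemma aqchar1 : aqchar 1 = 1.
Proof. by rewrite -[1 in LHS](aqpi1 R) aqchar_pi. Qed.

Lemma algquot_neq0 : (1 : algquot R) != 0.
Proof.
apply/eqP=> /(congr1 aqchar); rewrite aqchar1 -(linear0 (aqpi R)) aqchar_pi chi0.
by apply/eqP/oner_neq0.
Qed.

End Character.

Section FreeAlgebra.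
Variables (k : fieldType) (X : choiceType).

(* k<X>, the monoid algebra of the free monoid on X *)
Definition freealg := {malg k[{fmonom X}]}.

HB.instance Definition _ := GRing.Lalgebra.on freealg.

Fact freealg_scalerAr (c : k) (x y : freealg) : c *: (x * y) = x * (c *: y).
Proof.
have cC z : z * c%:MP = c *: z :> freealg.
  rewrite malgM_def malgZ_def fgmulgU; apply/eq_bigr=> /= m _.
  by rewrite mulm1 mulrC.
by rewrite -!cC mulrA.
Qed.

HB.instance Definition _ := GRing.Lalgebra_isAlgebra.Build k freealg
  freealg_scalerAr.

Definition free_gen (x : X) : freealg := << fmu x >>.

Variable f : X -> k.

Definition free_eval_monom (m : {fmonom X}) : k := \prod_(x <- (m : seq X)) f x.

Fact free_eval_monom_mmorphism : mmorphism free_eval_monom.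
Proof.
split=> [m1 m2|]; rewrite /free_eval_monom.
  by rewrite fmM big_cat.
by rewrite fm1 big_nil.
Qed.

HB.instance Definition _ := isMultiplicative.Build {fmonom X} k
  free_eval_monom free_eval_monom_mmorphism.

Definition free_eval (x : freealg) : k := mmap idfun free_eval_monom x.

Lemma free_eval_character : is_character free_eval.
Proof.
split=> [c x y|x y|]; rewrite /free_eval.
- by rewrite raddfD /= mmapZ.
- by rewrite rmorphM.
- by rewrite rmorph1.
Qed.

Lemma free_eval_gen x : free_eval (free_gen x) = f x.
Proof. by rewrite /free_eval mmapU mul1r /free_eval_monom fmuE big_seq1. Qed.

End FreeAlgebra.

#[global] Opaque free_gen free_eval.

Section Tensor.
Variables (k : fieldType) (U V : lmodType k).

Definition free_pair (u : U) (v : V) : {malg k[(U * V)%type]} := << (u, v) >>.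

Inductive tensor_rel : {malg k[(U * V)%type]} -> Prop :=
| tensor_rel_l c u u' v :
    tensor_rel (free_pair (c *: u + u') v
                - (c *: free_pair u v + free_pair u' v))
| tensor_rel_r c u v v' :
    tensor_rel (free_pair u (c *: v + v')
                - (c *: free_pair u v + free_pair u v')).

Definition tensor := linquot tensor_rel.

HB.instance Definition _ := GRing.Lmodule.on tensor.

Definition tens (u : U) (v : V) : tensor := lqpi tensor_rel (free_pair u v).

Definition free_lift (W : lmodType k) (f : U -> V -> W)
    (g : {malg k[(U * V)%type]}) : W :=
  \sum_(p <- msupp g) g@_p *: f p.1 p.2.

(* The linear map tensor U V -> W induced by f, meaningful for bilinear f
   (tlift_tens, tlift_linear); for other f the value depends on the choice of
   representatives. *)
Definition tlift (W : lmodType k) (f : U -> V -> W) (t : tensor) : W :=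
  free_lift f (lqrepr t).

Definition bilinear_fun (W : lmodType k) (f : U -> V -> W) : Prop :=
  (forall c u u' v, f (c *: u + u') v = c *: f u v + f u' v) /\
  (forall c u v v', f u (c *: v + v') = c *: f u v + f u v').

Lemma tens_bilinear : bilinear_fun tens.
Proof.
split=> c u u' v; rewrite /tens -(lqpi_linear tensor_rel c);
  apply/lqpiP/span_gen; [exact: tensor_rel_l | exact: tensor_rel_r].
Qed.

Section Lift.
Variables (W : lmodType k) (f : U -> V -> W).

Lemma free_lift_le (d : {fset U * V}) g : (msupp g `<=` d)%fset ->
  free_lift f g = \sum_(p <- d) g@_p *: f p.1 p.2.
Proof.
move=> le; rewrite /free_lift (big_fset_incl _ le) //= => p _ /mcoeff_outdom ->.
by rewrite scale0r.
Qed.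

Lemma free_lift_linear : linear (free_lift f).
Proof.
move=> c x y; set d := (msupp (c *: x + y) `|` (msupp x `|` msupp y))%fset.
rewrite !(@free_lift_le d) ?fsubsetUl //.
- rewrite scaler_sumr -big_split /=; apply: eq_bigr => p _.
  by rewrite mcoeffD mcoeffZ scalerDl scalerA.
- by rewrite /d fsetUA fsubsetUr.
- by rewrite /d fsetUCA fsubsetUl.
Qed.

HB.instance Definition _ := GRing.isLinear.Build k {malg k[(U * V)%type]} W *:%R
  (free_lift f) free_lift_linear.

Lemma free_lift_pair u v : free_lift f (free_pair u v) = f u v.
Proof.
rewrite (free_lift_le (msuppU_le)) big_seq_fset1 mcoeffUU.
by rewrite scale1r.
Qed.

Hypothesis f_bilin : bilinear_fun f.

Lemma tlift_pi g : tlift f (lqpi tensor_rel g) = free_lift f g.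
Proof.
apply/eqP; rewrite -subr_eq0 -linearB /=; apply/eqP.
have [fl fr] := f_bilin.
elim: (lqrepr_pi tensor_rel g) => [|c x y rx _ IH]; first by rewrite linear0.
rewrite free_lift_linear IH addr0.
suff -> : free_lift f x = 0 by rewrite scaler0.
by case: rx => *; rewrite linearB /= free_lift_linear !free_lift_pair
  ?fl ?fr subrr.
Qed.

Lemma tlift_tens u v : tlift f (tens u v) = f u v.
Proof. by rewrite tlift_pi free_lift_pair. Qed.

Lemma tlift_linear : linear (tlift f).
Proof.
move=> c; elim/lqind=> x; elim/lqind=> y.
by rewrite -linearP !tlift_pi linearP.
Qed.

End Lift.

Lemma tens_ind (P : tensor -> Prop) :
  (forall u v, P (tens u v)) -> P 0 ->
  (forall c s t, P s -> P t -> P (c *: s + t)) -> forall t, P t.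
Proof.
move=> Pt P0 PD; elim/lqind=> g.
rewrite [g]monalgE linear_sum /=.
elim/big_ind: _ => [//|x y Px Py|p _].
  by rewrite -[x]scale1r; apply: PD.
have -> : << g@_p *g p >> = g@_p *: free_pair p.1 p.2.
  by apply/malgP=> q; rewrite mcoeffZ !mcoeffU -surjective_pairing mulr_natr.
by rewrite linearZ /= -[X in P X]addr0; apply: PD => //; exact: Pt.
Qed.

End Tensor.

#[global] Opaque tens tlift.

Section DoubleBracket.
Variables (k : fieldType) (A : algType k) (I : finType) (e : I -> A).

Notation AA := (tensor A A).
Notation AAA := (tensor (tensor A A) A).

Definition tens3 (x y z : A) : AAA := tens (tens x y) z.

(* x (a' (x) a'') = x a' (x) a'' and (a' (x) a'') y = a' (x) a'' y *)
Definition outerl (x : A) (t : AA) : AA := tlift (fun u v => tens (x * u) v) t.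
Definition outerr (t : AA) (y : A) : AA := tlift (fun u v => tens u (v * y)) t.

Definition tau12 (t : AA) : AA := tlift (fun u v => tens v u) t.

Definition tau123 (t : AAA) : AAA :=
  tlift (fun s x3 => tlift (fun x1 x2 => tens3 x3 x1 x2) s) t.
Definition tau132 (t : AAA) : AAA :=
  tlift (fun s x3 => tlift (fun x1 x2 => tens3 x2 x3 x1) s) t.

Lemma outerl_tens x u v : outerl x (tens u v) = tens (x * u) v.
Proof.
have [tl tr] := tens_bilinear A A.
by apply: tlift_tens; split=> *; rewrite ?mulrDr -?scalerAr ?tl ?tr.
Qed.

Lemma outerr_tens u v y : outerr (tens u v) y = tens u (v * y).
Proof.
have [tl tr] := tens_bilinear A A.
by apply: tlift_tens; split=> *; rewrite ?mulrDl -?scalerAl ?tl ?tr.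
Qed.

Lemma tau12_tens u v : tau12 (tens u v) = tens v u.
Proof.
have [tl tr] := tens_bilinear A A.
by apply: tlift_tens; split=> *; rewrite ?tl ?tr.
Qed.

Lemma tens3_linear1 c x x' y z :
  tens3 (c *: x + x') y z = c *: tens3 x y z + tens3 x' y z.
Proof.
by rewrite /tens3 (tens_bilinear _ _).1 (tens_bilinear _ _).1.
Qed.

Lemma tens3_linear2 c x y y' z :
  tens3 x (c *: y + y') z = c *: tens3 x y z + tens3 x y' z.
Proof.
by rewrite /tens3 (tens_bilinear _ _).2 (tens_bilinear _ _).1.
Qed.

Lemma tens3_linear3 c x y z z' :
  tens3 x y (c *: z + z') = c *: tens3 x y z + tens3 x y z'.
Proof. by rewrite /tens3 (tens_bilinear _ _).2. Qed.

Definition tens3_linear := (tens3_linear1, tens3_linear2, tens3_linear3).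

Lemma trilift_tens3 (f : A -> A -> A -> AAA) :
  (forall c x x' y z, f (c *: x + x') y z = c *: f x y z + f x' y z) ->
  (forall c x y y' z, f x (c *: y + y') z = c *: f x y z + f x y' z) ->
  (forall c x y z z', f x y (c *: z + z') = c *: f x y z + f x y z') ->
  forall x y z,
    tlift (fun s x3 => tlift (fun x1 x2 => f x1 x2 x3) s) (tens3 x y z)
      = f x y z.
Proof.
move=> f1 f2 f3.
have fb x3 : bilinear_fun (fun x1 x2 => f x1 x2 x3) by split.
move=> x y z; rewrite /tens3 tlift_tens ?tlift_tens //.
split=> [c s s' x3|c s x3 x3']; first exact: tlift_linear.
elim/tens_ind: s => [u v||d s t IHs IHt]; first by rewrite !tlift_tens.
  have L0 w : tlift (fun x1 x2 => f x1 x2 w) (0 : AA) = 0.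
    have := tlift_linear (fb w) 1 0 0; rewrite !scale1r addr0 => /eqP.
    by rewrite -subr_eq0 opprD addNKr oppr_eq0 => /eqP.
  by rewrite !L0 scaler0 addr0.
rewrite (tlift_linear (fb _) d s t) IHs IHt.
rewrite (tlift_linear (fb x3) d s t) (tlift_linear (fb x3') d s t).
rewrite scalerDr.
rewrite scalerDr.
rewrite scalerA.
rewrite scalerA.
rewrite (mulrC d c).
by rewrite [LHS]addrACA.
Qed.

Lemma tau123_tens3 x y z : tau123 (tens3 x y z) = tens3 z x y.
Proof.
by apply: (@trilift_tens3 (fun x1 x2 x3 => tens3 x3 x1 x2)) => *;
  rewrite tens3_linear.
Qed.

Lemma tau132_tens3 x y z : tau132 (tens3 x y z) = tens3 y z x.
Proof.
by apply: (@trilift_tens3 (fun x1 x2 x3 => tens3 x2 x3 x1)) => *;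
  rewrite tens3_linear.
Qed.

Definition orthogonal_idempotents : Prop :=
  (forall s t, e s * e t = if s == t then e s else 0) /\ \sum_s e s = 1.

Variable db : A -> A -> AA.

(* B is the span of the e s. *)
Definition double_bracket : Prop :=
  [/\ bilinear_fun db,
      forall a b, db a b = - tau12 (db b a),
      forall a b c, db a (b * c) = outerr (db a b) c + outerl b (db a c)
    & forall a (c : I -> k), db a (\sum_s c s *: e s) = 0].

Definition dbL (a : A) (t : AA) : AAA := tlift (fun b c => tens (db a b) c) t.

Definition triple_bracket (a b c : A) : AAA :=
  dbL a (db b c) + tau123 (dbL b (db c a)) + tau132 (dbL c (db a b)).

Definition quasi_Poisson : Prop := forall a b c,
  triple_bracket a b c = 4^-1 *: \sum_s
    (tens3 (c * e s * a) (e s * b) (e s)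
     - tens3 (c * e s * a) (e s) (b * e s)
     - tens3 (c * e s) (a * e s * b) (e s)
     + tens3 (c * e s) (a * e s) (b * e s)
     - tens3 (e s * a) (e s * b) (e s * c)
     + tens3 (e s * a) (e s) (b * e s * c)
     + tens3 (e s) (a * e s * b) (e s * c)
     - tens3 (e s) (a * e s) (b * e s * c)).

Definition multiplicative_moment_map (Phi : A) : Prop :=
  (exists Psi, Phi * Psi = 1 /\ Psi * Phi = 1) /\
  exists Phi_ : I -> A,
    [/\ Phi = \sum_s Phi_ s,
        forall s, exists x, Phi_ s = e s * x * e s
      & forall a s, db (Phi_ s) a = 2^-1 *:
          (tens (a * e s) (Phi_ s) - tens (e s) (Phi_ s * a)
           + tens (a * Phi_ s) (e s) - tens (Phi_ s) (e s * a))].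

Definition Hamiltonian_double_quasi_Poisson (Phi : A) : Prop :=
  [/\ orthogonal_idempotents, double_bracket, quasi_Poisson
    & multiplicative_moment_map Phi].

End DoubleBracket.

Section PathAlgebra.
Variables (k : fieldType) (I : finType) (Q : choiceType) (src tgt : Q -> I).

Let F : algType k := freealg k (I + Q)%type.
Let fe (s : I) : F := free_gen k (inl s).
Let fq (q : Q) : F := free_gen k (inr q).

(* Paths are read from right to left. *)
Inductive path_rel : F -> Prop :=
| path_rel_idem s t : path_rel (fe s * fe t - (if s == t then fe s else 0))
| path_rel_one : path_rel (\sum_s fe s - 1)
| path_rel_arrow q : path_rel (fq q - fe (tgt q) * fq q * fe (src q)).

Definition path_algebra := algquot path_rel.

HB.instance Definition _ := GRing.Lmodule.on path_algebra.
HB.instance Definition _ := GRing.PzRing.on path_algebra.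

Definition path_idem (s : I) : path_algebra := aqpi path_rel (fe s).
Definition path_arrow (q : Q) : path_algebra := aqpi path_rel (fq q).

End PathAlgebra.

Section Localization.
Variables (k : fieldType) (A : algType k) (J : choiceType) (e x : J -> A).

Let F : algType k := freealg k (A + J)%type.
Let fa (a : A) : F := free_gen k (inl a).
Let fi (j : J) : F := free_gen k (inr j).

(* A with an inverse y_j = e_j y_j e_j adjoined to every x_j in e_j A e_j: the
   elements of A are generators subject to all relations that hold in A, and
   there is one further generator y_j for every j. *)
Inductive loc_rel : F -> Prop :=
| loc_rel_lin c a b : loc_rel (fa (c *: a + b) - (c *: fa a + fa b))
| loc_rel_mul a b : loc_rel (fa (a * b) - fa a * fa b)
| loc_rel_one : loc_rel (fa 1 - 1)
| loc_rel_idem j : loc_rel (fi j - fa (e j) * fi j * fa (e j))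
| loc_rel_invr j : loc_rel (fa (x j) * fi j - fa (e j))
| loc_rel_invl j : loc_rel (fi j * fa (x j) - fa (e j)).

Definition localization := algquot loc_rel.

HB.instance Definition _ := GRing.Lmodule.on localization.
HB.instance Definition _ := GRing.PzRing.on localization.

Definition loc_map (a : A) : localization := aqpi loc_rel (fa a).
Definition loc_inv (j : J) : localization := aqpi loc_rel (fi j).

End Localization.

Section Gamma.
Variables (k : fieldType) (n : nat).

Definition v1 : 'I_2 := ord0.
Definition v2 : 'I_2 := ord_max.

(* inl i is the arrow a_i : 1 -> 2 and inr i is the arrow b_i : 2 -> 1. *)
Definition arrow := ('I_n + 'I_n)%type.
Definition arrow_src (q : arrow) : 'I_2 := if q is inl _ then v1 else v2.
Definition arrow_tgt (q : arrow) : 'I_2 := if q is inl _ then v2 else v1.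

Definition Gamma_path := path_algebra k arrow_src arrow_tgt.

HB.instance Definition _ := GRing.Lmodule.on Gamma_path.
HB.instance Definition _ := GRing.PzRing.on Gamma_path.

(* The one-dimensional representation at the vertex 1 shows that Gamma_path and
   its localization BGamma are nonzero. *)
Let chi0 (g : 'I_2 + arrow) : k := if g is inl s then (s == v1)%:R else 0.

Let chi0_rel r : path_rel arrow_src arrow_tgt r -> free_eval chi0 r = 0.
Proof.
have [fL fM f1] := free_eval_character chi0.
have [fB fD] := (characterB (free_eval_character chi0),
  characterD (free_eval_character chi0)).
case=> [s t||q]; rewrite fB.
- rewrite fM !free_eval_gen /=; have [->|st] := eqVneq s t.
    by rewrite free_eval_gen /= -natrM mulnb andbb subrr.
  rewrite (character0 (free_eval_character chi0)) subr0 -natrM mulnb.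
  by case: (eqVneq s v1) st => // ->; rewrite eq_sym => /negPf->.
- by rewrite f1 big_ord_recl big_ord1 fD !free_eval_gen /= addr0 subrr.
- by rewrite !fM !free_eval_gen /= mulr0 mul0r subrr.
Qed.

Fact Gamma_path_neq0 : (1 : Gamma_path) != 0.
Proof. exact: algquot_neq0 (free_eval_character chi0) chi0_rel. Qed.

HB.instance Definition _ :=
  GRing.PzSemiRing_isNonZero.Build Gamma_path Gamma_path_neq0.
HB.instance Definition _ :=
  GRing.Lmodule_isLalgebra.Build k Gamma_path (@aq_scalerAl _ _ _).
HB.instance Definition _ :=
  GRing.Lalgebra_isAlgebra.Build k Gamma_path (@aq_scalerAr _ _ _).

Definition Gamma_idem (s : 'I_2) : Gamma_path := path_idem k arrow_src arrow_tgt s.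
Definition Gamma_arrow (q : arrow) : Gamma_path :=
  path_arrow k arrow_src arrow_tgt q.

(* rev_continuant [:: y_k; ...; y_1] is the continuant (y_1, ..., y_k) of an
   alternating sequence of arrows; the value at [::] is never used for k > 0. *)
Fixpoint rev_continuant (w : seq arrow) : Gamma_path :=
  match w with
  | [::] => 1
  | [:: y] => Gamma_arrow y
  | [:: y2; y1] =>
      Gamma_idem (arrow_tgt y1) + Gamma_arrow y1 * Gamma_arrow y2
  | y :: ((_ :: w'') as w') =>
      rev_continuant w' * Gamma_arrow y + rev_continuant w''
  end.

Definition continuant (w : seq arrow) : Gamma_path := rev_continuant (rev w).

(* a_1, b_1, ..., a_n, b_n *)
Definition Gamma_word : seq arrow :=
  flatten [seq [:: inl i; inr i] | i <- enum 'I_n].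

(* The continuants to be inverted: (b_n, a_n, ..., b_1, a_1) at the vertex 1 and
   (a_1, b_1, ..., a_n, b_n) at the vertex 2. *)
Definition Gamma_continuant (s : 'I_2) : Gamma_path :=
  if s == v1 then continuant (rev Gamma_word) else continuant Gamma_word.

Definition BGamma := localization Gamma_idem Gamma_continuant.

HB.instance Definition _ := GRing.Lmodule.on BGamma.
HB.instance Definition _ := GRing.PzRing.on BGamma.

Let chi1 (x : Gamma_path) : k := aqchar (free_eval chi0) x.

Let chi1_character : is_character chi1.
Proof.
split=> [c x y|x y|].
- exact: aqcharL (free_eval_character chi0) chi0_rel c x y.
- exact: aqcharM (free_eval_character chi0) chi0_rel x y.
- exact: aqchar1 (free_eval_character chi0) chi0_rel.
Qed.

Let chi1_idem s : chi1 (Gamma_idem s) = (s == v1)%:R.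
Proof.
rewrite /chi1 (aqchar_pi (free_eval_character chi0) chi0_rel).
exact: free_eval_gen.
Qed.

Let chi1_arrow q : chi1 (Gamma_arrow q) = 0.
Proof.
rewrite /chi1 (aqchar_pi (free_eval_character chi0) chi0_rel).
exact: free_eval_gen.
Qed.

Let chi1_continuant : chi1 (Gamma_continuant v1) = 1.
Proof.
have [chiL chiM chi11] := chi1_character.
have chiD := characterD chi1_character.
rewrite /Gamma_continuant eqxx /continuant revK /Gamma_word.
elim: (enum 'I_n) => [|i [|j l] IH]; first exact: chi11.
  by rewrite /= chiD chiM chi1_idem !chi1_arrow mulr0 addr0.
rewrite -IH [LHS]/= chiD chiM chi1_arrow mulr0 add0r.
by [].
Qed.

Let chi2 (g : Gamma_path + 'I_2) : k :=
  match g with inl x => chi1 x | inr s => (s == v1)%:R end.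

Let chi2_rel r :
  loc_rel Gamma_idem Gamma_continuant r -> free_eval chi2 r = 0.
Proof.
have [fL fM f1] := free_eval_character chi2.
have [chiL chiM chi11] := chi1_character.
have fB := characterB (free_eval_character chi2).
have bb (b : bool) : b%:R * b%:R = b%:R :> k by rewrite -natrM mulnb andbb.
have cs s : chi1 (Gamma_continuant s) * (s == v1)%:R = (s == v1)%:R.
  by case: eqP => [->|_]; rewrite ?mulr0 // chi1_continuant mul1r.
case=> [c x y|x y||s|s|s]; rewrite fB.
- by rewrite fL !free_eval_gen /= chiL subrr.
- by rewrite fM !free_eval_gen /= chiM subrr.
- by rewrite f1 free_eval_gen /= chi11 subrr.
- by rewrite fM fM !free_eval_gen /= chi1_idem !bb subrr.
- by rewrite fM !free_eval_gen /= chi1_idem cs subrr.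
- by rewrite fM !free_eval_gen /= chi1_idem mulrC cs subrr.
Qed.

Fact BGamma_neq0 : (1 : BGamma) != 0.
Proof. exact: algquot_neq0 (free_eval_character chi2) chi2_rel. Qed.

HB.instance Definition _ :=
  GRing.PzSemiRing_isNonZero.Build BGamma BGamma_neq0.
HB.instance Definition _ :=
  GRing.Lmodule_isLalgebra.Build k BGamma (@aq_scalerAl _ _ _).
HB.instance Definition _ :=
  GRing.Lalgebra_isAlgebra.Build k BGamma (@aq_scalerAr _ _ _).

Definition BGamma_of_path (x : Gamma_path) : BGamma :=
  loc_map Gamma_idem Gamma_continuant x.

Definition BGamma_idem (s : 'I_2) : BGamma := BGamma_of_path (Gamma_idem s).

(* The inverse of Gamma_continuant s in e_s BGamma e_s. *)
Definition BGamma_inv (s : 'I_2) : BGamma :=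
  loc_inv Gamma_idem Gamma_continuant s.

Definition BGamma_Phi : BGamma :=
  BGamma_of_path (continuant Gamma_word) + BGamma_inv v1.

Local Notation e1 := (BGamma_idem v1).
Local Notation e2 := (BGamma_idem v2).
Local Notation a_ i := (BGamma_of_path (Gamma_arrow (inl i))).
Local Notation b_ i := (BGamma_of_path (Gamma_arrow (inr i))).

Definition BGamma_bracket_values (db : BGamma -> BGamma -> tensor BGamma BGamma) :
  Prop := forall i j : 'I_n,
  [/\ db (a_ i) (a_ j) =
        if (i < j)%N then - (2^-1 *: (tens (a_ i) (a_ j) + tens (a_ j) (a_ i)))
        else if i == j then 0
        else 2^-1 *: (tens (a_ i) (a_ j) + tens (a_ j) (a_ i)),
      db (b_ i) (b_ j) =
        if (i < j)%N then - (2^-1 *: (tens (b_ i) (b_ j) + tens (b_ j) (b_ i)))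
        else if i == j then 0
        else 2^-1 *: (tens (b_ i) (b_ j) + tens (b_ j) (b_ i)),
      db (a_ i) (b_ j) =
        if (i < j)%N then
          2^-1 *: (tens e1 (a_ i * b_ j) + tens (b_ j * a_ i) e2)
        else if i == j then
          2^-1 *: (tens (b_ i * a_ i) e2 + tens e1 (a_ i * b_ i)) + tens e1 e2
        else
          - (2^-1 *: (tens (b_ j * a_ i) e2 + tens e1 (a_ i * b_ j)))
          - (if i == j.+1 :> nat then tens e1 e2 else 0)
    & db (b_ i) (a_ j) =
        if (i < j)%N then
          2^-1 *: (tens e2 (b_ i * a_ j) + tens (a_ j * b_ i) e1)
          + (if j == i.+1 :> nat then tens e2 e1 else 0)
        else if i == j then
          - (2^-1 *: (tens e2 (b_ i * a_ i) + tens (a_ i * b_ i) e1)) - tens e2 e1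
        else
          - (2^-1 *: (tens (a_ j * b_ i) e1 + tens e2 (b_ i * a_ j)))].

End Gamma.

(* Main.v *)
Require Import Defs.
From HB Require Import structures.
From mathcomp Require Import all_boot all_algebra.
From mathcomp Require Import boolp.
From mathcomp Require Import finmap monalg.
From mathcomp Require Import ring zify.

Set Implicit Arguments.
Unset Strict Implicit.
Unset Printing Implicit Defensive.

Import GRing.Theory.
Local Open Scope ring_scope.

(** The localized path algebra enters only through its induction principle and
   its universal property; derivations into a bimodule M are algebra morphisms
   into the square-zero extension by M, so a double bracket exists, and is unique,
   for every antisymmetric choice of values on the arrows.  Order the arrows as
   the letters y_0 < y_1 < ... of a_1 b_1 ... a_n b_n: all the given values become
   one formula for {{y_i, y_j}} with i < j, in which a constant term appears only
   for j = i + 1.  Both sides of the quasi-Poisson identity are derivations in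
   each argument and cyclically equivariant, so it has to be checked on triples of
   letters only, where it is a finite case analysis on their order and sources.
   The brackets of the prefix continuants with a letter have a closed form, which
   depends on whether the letter belongs to the prefix and follows by induction
   from the continuant recursion.  Reversing the word changes the sign of the
   bracket, so the reversed continuant X satisfies the moment map condition up to
   sign, and its inverse satisfies it. *)

(** * Universal properties *)

(** A bracket is extended from the arrows one argument at a time, for the outer bimodule structure
    in the second argument and for the inner one in the first. That the result is a derivation in
    both arguments rests on the commutation of these two structures on [A \ox A].

    The two kinds of coefficients play different parts. The square of the coefficient 1/2 of the
    quadratic terms is the 1/4 of the quasi-Poisson identity, in which the contributions of the
    constant terms cancel among themselves. It is the brackets of continuants that tie the constants
    to 1/2: when the letter is one of the last two of a prefix, the constant 1 yields a full copy of
    a term of which the quadratic part supplies a half with the opposite sign, and 1 - 1/2 = 1/2 is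
    what the closed form asks for.

    That closed form is a table indexed by parities because a prefix of odd length has the type of a
    letter, whereas a prefix of even length is a loop. *)

Section LinearMaps.
Variable k : fieldType.

Section Rules.
Variables (U V : lmodType k) (f : U -> V).
Hypothesis fL : linear f.

Lemma lin0 : f 0 = 0.
Proof.
have := fL 1 0 0; rewrite !scale1r addr0 => /eqP.
by rewrite -subr_eq0 opprD addNKr oppr_eq0 => /eqP.
Qed.

Lemma linD x y : f (x + y) = f x + f y.
Proof. by have := fL 1 x y; rewrite !scale1r. Qed.

Lemma linZ c x : f (c *: x) = c *: f x.
Proof. by rewrite -[c *: x]addr0 fL lin0 addr0. Qed.

Lemma linN x : f (- x) = - f x.
Proof. by rewrite -scaleN1r linZ scaleN1r. Qed.

Definition lin_rules := (linD, linN, linZ, lin0).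
End Rules.

Lemma linear_comp (U V W : lmodType k) (f : V -> W) (g : U -> V) :
  linear f -> linear g -> linear (fun x => f (g x)).
Proof. by move=> fL gL c x y; rewrite gL fL. Qed.

Lemma linear_add (U V : lmodType k) (f g : U -> V) :
  linear f -> linear g -> linear (fun x => f x + g x).
Proof. by move=> fL gL c x y; rewrite fL gL scalerDr addrACA. Qed.

Lemma linear_scale (U V : lmodType k) (f : U -> V) c :
  linear f -> linear (fun x => c *: f x).
Proof. by move=> fL c' x y; rewrite fL scalerDr !scalerA mulrC. Qed.

Lemma linear_id (U : lmodType k) : linear (fun x : U => x).
Proof. by []. Qed.

End LinearMaps.

Section UniversalProperties.
Variable k : fieldType.

Local Transparent free_gen.

Definition alg_morphism (A C : algType k) (F : A -> C) : Prop :=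
  [/\ linear F, {morph F : x y / x * y} & F 1 = 1].

Lemma freealg_ind (X : choiceType) (P : freealg k X -> Prop) :
  (forall c x y, P x -> P y -> P (c *: x + y)) ->
  (forall x y, P x -> P y -> P (x * y)) -> P 1 ->
  (forall x, P (free_gen k x)) -> forall u, P u.
Proof.
move=> PL PM P1 Pg u.
have P0 : P 0 by rewrite -(addNr 1) -scaleN1r; apply: PL.
rewrite [u]monalgE; elim/big_ind: _ => // [x y Px Py|m _].
  by rewrite -[x]scale1r; apply: PL.
have -> : << u@_m *g m >> = u@_m *: << m >> :> freealg k X.
  by apply/malgP=> q; rewrite mcoeffZ !mcoeffU mulr_natr.
rewrite -[X in P X]addr0; apply: PL => //.
case: m => s; elim: s => [|x s IH].
  by rewrite -fmoneE; exact: P1.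
have -> : << FMonom (x :: s) >> = free_gen k x * << FMonom s >>.
  rewrite malgM_def fgmulUU mulr1; congr << _ *g _ >>.
  by apply/eqP; rewrite fmP fmM fmuE.
exact: PM.
Qed.

Lemma freealg_hom (X : choiceType) (C : algType k) (f : X -> C) :
  exists F : freealg k X -> C,
    alg_morphism F /\ forall x, F (free_gen k x) = f x.
Proof.
pose h (m : {fmonom X}) : C := \prod_(x <- (m : seq X)) f x.
have hM : mmorphism h.
  by split=> [m1 m2|]; rewrite /h ?fmM ?big_cat // fm1 big_nil.
pose H := isMultiplicative.Build {fmonom X} C h hM.
pose h' : MMorphism.type {fmonom X} C := HB.pack h H.
pose F := mmap (in_alg C) h'.
(* The target is not commutative. Multiplicativity of [mmap] only asks that the images of the
   coefficients, here scalars, be central. *)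
have cF g m m' : GRing.comm (in_alg C (g : {malg k[{fmonom X}]})@_m) (h' m').
  by rewrite /GRing.comm /= mulr_algl mulr_algr.
have [FM F1] := commr_mmap_is_multiplicative (f := in_alg C) cF.
exists F; split=> [|x]; first split=> // c x y.
  rewrite /F raddfD; congr (_ + _).
  by rewrite [LHS](mmapZ (f := in_alg C) (h := h') c x) /= mulr_algl.
by rewrite /F mmapU /= scale1r mul1r /h fmuE big_seq1.
Qed.

(** The quotient may be the zero ring and is then no [algType], so the conclusion spells out the
    clauses of [alg_morphism]. *)
Lemma algquot_hom (A C : algType k) (R : A -> Prop) (F : A -> C) :
  alg_morphism F ->
  (forall r, R r -> F r = 0) ->
  exists G : algquot R -> C,
    [/\ forall c x y, G (c *: x + y) = c *: G x + G y,
        {morph G : x y / x * y}, G 1 = 1 & forall x, G (aqpi R x) = F x].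
Proof.
case=> FL FM F1 FR.
have h z : Defs.span (ideal_gen R) z -> F z = 0.
  elim=> [|c u v [a [r [b [Rr ->]]]] _ IH]; first exact: lin0 FL.
  by rewrite FL IH !FM (FR _ Rr) mulr0 mul0r scaler0 addr0.
have Gpi x : F (lqrepr (aqpi R x)) = F x.
  rewrite -[lqrepr _](subrK x) -[_ - x]scale1r FL scale1r.
  by rewrite h ?add0r //; exact: lqrepr_pi.
have GL c (x y : algquot R) :
    F (lqrepr (c *: x + y)) = c *: F (lqrepr x) + F (lqrepr y).
  by elim/aqind: x => x; elim/aqind: y => y; rewrite -linearP !Gpi FL.
have GM (x y : algquot R) : F (lqrepr (x * y)) = F (lqrepr x) * F (lqrepr y).
  by elim/aqind: x => x; elim/aqind: y => y; rewrite -aqpiM !Gpi FM.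
exists (fun u => F (lqrepr u)); split=> [c x y|x y||x].
- exact: GL.
- exact: GM.
- by rewrite -(aqpi1 R) Gpi.
- exact: Gpi.
Qed.

End UniversalProperties.

(** * Induction and universal property of the localized path algebra *)

Section BGammaUniversal.
Variables (k : fieldType) (n : nat).
Local Notation GP := (Gamma_path k n).
Local Notation BG := (BGamma k n).
Local Notation iota := (@BGamma_of_path k n).
Local Notation e := (@BGamma_idem k n).
Local Notation inv := (@BGamma_inv k n).
Local Notation cont := (@Gamma_continuant k n).

Lemma alg_morphism_facts (A C : algType k) (F : A -> C) : alg_morphism F ->
  [/\ F 0 = 0, {morph F : x y / x + y} & {morph F : x y / x - y}].
Proof.
move=> [FL FM F1].
by split; [exact: lin0 FL | exact: linD FL |
  by move=> x y; rewrite (linD FL) (linN FL)].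
Qed.

Lemma Gamma_path_ind (P : GP -> Prop) :
  (forall c x y, P x -> P y -> P (c *: x + y)) ->
  (forall x y, P x -> P y -> P (x * y)) ->
  (forall s, P (Gamma_idem k n s)) -> (forall q, P (Gamma_arrow k q)) ->
  forall u, P u.
Proof.
move=> PL PM Pe Pq; elim/aqind=> u.
elim/freealg_ind: u => [c x y Px Py|x y Px Py||[s|q]].
- by rewrite linearP; apply: PL.
- by rewrite aqpiM; apply: PM.
(* The unit is the sum of the two idempotents, so [Pe] covers it. *)
- have := aqpi_rel (path_rel_one k (@arrow_src n) (@arrow_tgt n)).
  rewrite linearB big_ord_recl big_ord1 => /eqP; rewrite subr_eq0 => /eqP <-.
  rewrite linearD -[X in X + _]scale1r.
  by apply: PL; [exact: (Pe ord0) | exact: (Pe (lift ord0 ord0))].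
- exact: Pe.
- exact: Pq.
Qed.

Lemma Gamma_path_hom (C : algType k) (E : 'I_2 -> C) (Q : arrow n -> C) :
  orthogonal_idempotents E ->
  (forall q, Q q = E (arrow_tgt q) * Q q * E (arrow_src q)) ->
  exists F : GP -> C, [/\ alg_morphism F,
    forall s, F (Gamma_idem k n s) = E s & forall q, F (Gamma_arrow k q) = Q q].
Proof.
move=> [EE E1] QE.
have [f [fA fg]] := freealg_hom
  (fun g : 'I_2 + arrow n => match g with inl s => E s | inr q => Q q end).
have [f0 fD fB] := alg_morphism_facts fA; have [fL fM f1] := fA.
have fR r : path_rel (@arrow_src n) (@arrow_tgt n) r -> f r = 0.
  case=> [s t||q]; rewrite fB.
  - by rewrite fM !fg EE; case: eqP; rewrite ?f0 ?fg ?subrr.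
  - by rewrite f1 (big_morph f fD f0) -E1; apply/eqP; rewrite subr_eq0; apply/eqP;
      apply: eq_bigr => s _; rewrite fg.
  - by rewrite !fM !fg -QE subrr.
have [F [FL FM F1 Fpi]] := algquot_hom (R := path_rel (@arrow_src n) (@arrow_tgt
    n)) fA fR.
by exists F; split=> [|s|q]; rewrite ?Fpi ?fg.
Qed.

Fact BGamma_of_path_morphism : alg_morphism iota.
Proof.
have h := fun r => @aqpi_rel k _ (loc_rel (@Gamma_idem k n) cont) r.
split=> [c x y|x y|].
- have := h _ (loc_rel_lin _ _ c x y); rewrite linearB /= linearP => /eqP.
  by rewrite subr_eq0 => /eqP.
- have := h _ (loc_rel_mul _ _ x y); rewrite linearB /= aqpiM => /eqP.
  by rewrite subr_eq0 => /eqP.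
- have := h _ (loc_rel_one _ _); rewrite linearB /= aqpi1 => /eqP.
  by rewrite subr_eq0 => /eqP.
Qed.

Fact Gamma_idem_orth : orthogonal_idempotents (@Gamma_idem k n).
Proof.
have h := fun r => @aqpi_rel k _ (path_rel (@arrow_src n) (@arrow_tgt n)) r.
split=> [s t|].
- have := h _ (path_rel_idem k _ _ s t); rewrite linearB /= aqpiM => /eqP.
  rewrite subr_eq0 => /eqP; rewrite /Gamma_idem /path_idem => ->.
  by case: eqP => // _; rewrite linear0.
- have := h _ (path_rel_one k _ _); rewrite linearB /= linear_sum => /eqP.
  by rewrite subr_eq0 => /eqP.
Qed.

Fact Gamma_arrow_typed q : Gamma_arrow k q =
  Gamma_idem k n (arrow_tgt q) * Gamma_arrow k q * Gamma_idem k n (arrow_src q).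
Proof.
have := aqpi_rel (path_rel_arrow k (@arrow_src n) (@arrow_tgt n) q).
by rewrite linearB /= !aqpiM => /eqP; rewrite subr_eq0 => /eqP.
Qed.

Lemma BGamma_idem_orth : orthogonal_idempotents e.
Proof.
have [i0 iD iB] := alg_morphism_facts BGamma_of_path_morphism.
have [iL iM i1] := BGamma_of_path_morphism; have [EE E1] := Gamma_idem_orth.
split=> [s t|]; first by rewrite -iM EE; case: eqP.
by rewrite -(big_morph iota iD i0) E1 i1.
Qed.

Lemma BGamma_inv_typed s : inv s = e s * inv s * e s.
Proof.
have := aqpi_rel (loc_rel_idem (@Gamma_idem k n) cont s).
by rewrite linearB /= !aqpiM => /eqP; rewrite subr_eq0 => /eqP.
Qed.

Lemma BGamma_invr s : iota (cont s) * inv s = e s.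
Proof.
have := aqpi_rel (loc_rel_invr (@Gamma_idem k n) cont s).
by rewrite linearB /= !aqpiM => /eqP; rewrite subr_eq0 => /eqP.
Qed.

Lemma BGamma_invl s : inv s * iota (cont s) = e s.
Proof.
have := aqpi_rel (loc_rel_invl (@Gamma_idem k n) cont s).
by rewrite linearB /= !aqpiM => /eqP; rewrite subr_eq0 => /eqP.
Qed.

(** The case of an inverse may assume [P] for the continuant that it inverts, because a derivation
    is determined on an inverse by its value on the element. *)
Lemma BGamma_ind (P : BG -> Prop) :
  (forall c x y, P x -> P y -> P (c *: x + y)) ->
  (forall x y, P x -> P y -> P (x * y)) ->
  (forall s, P (e s)) -> (forall q, P (iota (Gamma_arrow k q))) ->
  (forall s, P (iota (cont s)) -> P (inv s)) -> forall u, P u.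
Proof.
move=> PL PM Pe Pq Pi.
have [iL iM i1] := BGamma_of_path_morphism.
have Pp x : P (iota x).
  move: x; apply: Gamma_path_ind => // [c x y Px Py|x y Px Py].
    by rewrite iL; apply: PL.
  by rewrite iM; apply: PM.
elim/aqind=> u; elim/freealg_ind: u => [c x y Px Py|x y Px Py||[x|s]].
- by rewrite linearP; apply: PL.
- by rewrite aqpiM; apply: PM.
- by rewrite aqpi1 -i1.
- exact: Pp.
- exact: Pi.
Qed.

Lemma BGamma_hom (C : algType k) (F : GP -> C) (J : 'I_2 -> C) :
  alg_morphism F ->
  (forall s, J s = F (Gamma_idem k n s) * J s * F (Gamma_idem k n s)) ->
  (forall s, F (cont s) * J s = F (Gamma_idem k n s)) ->
  (forall s, J s * F (cont s) = F (Gamma_idem k n s)) ->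
  exists G : BG -> C, [/\ alg_morphism G, forall x, G (iota x) = F x
    & forall s, G (inv s) = J s].
Proof.
move=> FA JE FJ JF; have [FL FM F1] := FA.
have [f [fA fg]] := freealg_hom
  (fun g : GP + 'I_2 => match g with inl x => F x | inr s => J s end).
have [f0 fD fB] := alg_morphism_facts fA; have [fL fM f1] := fA.
have fR r : loc_rel (@Gamma_idem k n) cont r -> f r = 0.
  case=> [c x y|x y||s|s|s]; rewrite fB.
  - by rewrite fL !fg FL subrr.
  - by rewrite fM !fg FM subrr.
  - by rewrite f1 fg F1 subrr.
  - by rewrite !fM !fg -JE subrr.
  - by rewrite fM !fg FJ subrr.
  - by rewrite fM !fg JF subrr.
have [G [GL GM G1 Gpi]] := algquot_hom (R := loc_rel (@Gamma_idem k n) cont) fA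
    fR.
by exists G; split=> [|x|s]; rewrite ?Gpi ?fg.
Qed.

End BGammaUniversal.

(** * Derivations *)

Section Derivations.
Variables (k : fieldType) (A : algType k) (M : lmodType k).
Variables (l : A -> M -> M) (r : M -> A -> M).

(** The actions are plain functions, not canonical structures, because [A \ox A] is used with two
    bimodule structures, the outer and the inner one. *)
Record bimodule : Prop := Bimodule {
  bimod_linl : forall x, linear (l x);
  bimod_linl1 : forall m, linear (l^~ m);
  bimod_linr : forall x, linear (r^~ x);
  bimod_linr1 : forall m, linear (r m);
  bimod_l1 : forall m, l 1 m = m;
  bimod_r1 : forall m, r m 1 = m;
  bimod_lM : forall x y m, l (x * y) m = l x (l y m);
  bimod_rM : forall x y m, r m (x * y) = r (r m x) y;
  bimod_lr : forall x y m, l x (r m y) = r (l x m) y }.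

Definition derivation (D : A -> M) : Prop :=
  linear D /\ forall x y, D (x * y) = l x (D y) + r (D x) y.

Hypothesis H : bimodule.

Lemma bimod_l0 x : l x 0 = 0. Proof. exact: lin0 (bimod_linl H x). Qed.
Lemma bimod_r0 x : r 0 x = 0. Proof. exact: lin0 (bimod_linr H x). Qed.
Lemma bimod_lD x m m' : l x (m + m') = l x m + l x m'.
Proof. exact: linD (bimod_linl H x) _ _. Qed.
Lemma bimod_rD x m m' : r (m + m') x = r m x + r m' x.
Proof. exact: linD (bimod_linr H x) _ _. Qed.
Lemma bimod_lN x m : l x (- m) = - l x m.
Proof. exact: linN (bimod_linl H x) _. Qed.
Lemma bimod_rN x m : r (- m) x = - r m x.
Proof. exact: linN (bimod_linr H x) _. Qed.
Lemma bimod_lDl x y m : l (x + y) m = l x m + l y m.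
Proof. exact: linD (bimod_linl1 H m) _ _. Qed.
Lemma bimod_rDr x y m : r m (x + y) = r m x + r m y.
Proof. exact: linD (bimod_linr1 H m) _ _. Qed.
Lemma bimod_lZ c x m : l x (c *: m) = c *: l x m.
Proof. exact: linZ (bimod_linl H x) _ _. Qed.
Lemma bimod_rZ c x m : r (c *: m) x = c *: r m x.
Proof. exact: linZ (bimod_linr H x) _ _. Qed.
Lemma bimod_lZl c x m : l (c *: x) m = c *: l x m.
Proof. exact: linZ (bimod_linl1 H m) _ _. Qed.
Lemma bimod_rZr c x m : r m (c *: x) = c *: r m x.
Proof. exact: linZ (bimod_linr1 H m) _ _. Qed.

(* The square-zero extension of A by M: algebra morphisms into it over A are
   derivations of A in M. *)
Definition sqzero & bimodule : Type := (A * M)%type.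

Local Notation S := (sqzero H).

HB.instance Definition _ := GRing.Lmodule.copy S (A * M)%type.

Definition sqzero_mul (x y : S) : S := (x.1 * y.1, l x.1 y.2 + r x.2 y.1).
Definition sqzero_one : S := (1, 0).

Fact sqzero_mulA : associative sqzero_mul.
Proof.
move=> [x m] [y p] [z q]; rewrite /sqzero_mul /= mulrA bimod_lD bimod_rD.
by rewrite (bimod_lM H) (bimod_rM H) (bimod_lr H) addrA.
Qed.
Fact sqzero_mul1l : left_id sqzero_one sqzero_mul.
Proof.
by move=> [x m]; rewrite /sqzero_mul /= mul1r (bimod_l1 H) bimod_r0 addr0.
Qed.
Fact sqzero_mul1r : right_id sqzero_one sqzero_mul.
Proof.
by move=> [x m]; rewrite /sqzero_mul /= mulr1 (bimod_r1 H) bimod_l0 add0r.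
Qed.
Fact sqzero_mulDl : left_distributive sqzero_mul +%R.
Proof.
move=> [x m] [y p] [z q]; rewrite /sqzero_mul; congr pair => /=.
  exact: mulrDl.
by rewrite bimod_lDl bimod_rD addrACA.
Qed.
Fact sqzero_mulDr : right_distributive sqzero_mul +%R.
Proof.
move=> [x m] [y p] [z q]; rewrite /sqzero_mul; congr pair => /=.
  exact: mulrDr.
by rewrite bimod_rDr bimod_lD addrACA.
Qed.
Fact sqzero_neq0 : sqzero_one != 0.
Proof. by apply/eqP=> -[/eqP]; rewrite oner_eq0. Qed.

HB.instance Definition _ := GRing.Zmodule_isNzRing.Build S
  sqzero_mulA sqzero_mul1l sqzero_mul1r sqzero_mulDl sqzero_mulDr sqzero_neq0.

Fact sqzero_scalerAl (c : k) (x y : S) : c *: (x * y) = (c *: x) * y.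
Proof.
case: x y => [x m] [y p]; congr pair => /=; first exact: scalerAl.
by rewrite scalerDr bimod_lZl bimod_rZ.
Qed.

HB.instance Definition _ := GRing.Lmodule_isLalgebra.Build k S sqzero_scalerAl.

Fact sqzero_scalerAr (c : k) (x y : S) : c *: (x * y) = x * (c *: y).
Proof.
case: x y => [x m] [y p]; congr pair => /=; first exact: scalerAr.
by rewrite scalerDr bimod_lZ bimod_rZr.
Qed.

HB.instance Definition _ := GRing.Lalgebra_isAlgebra.Build k S sqzero_scalerAr.

Lemma sqzeroM (x y : S) : x * y = (x.1 * y.1, l x.1 y.2 + r x.2 y.1) :> S.
Proof. by []. Qed.

Lemma derivationD (D D' : A -> M) : derivation D -> derivation D' ->
  derivation (fun x => D x + D' x).
Proof.
move=> [DL DM] [DL' DM']; split=> [c x y|x y].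
  by rewrite DL DL' scalerDr addrACA.
by rewrite DM DM' bimod_lD bimod_rD addrACA.
Qed.

Lemma derivationZ c (D : A -> M) : derivation D ->
  derivation (fun x => c *: D x).
Proof.
move=> [DL DM]; split=> [c' x y|x y].
  by rewrite DL scalerDr !scalerA mulrC.
by rewrite DM scalerDr bimod_lZ bimod_rZ.
Qed.

Lemma derivationB (D D' : A -> M) : derivation D -> derivation D' ->
  derivation (fun x => D x - D' x).
Proof.
move=> DD /(derivationZ (-1)) /(derivationD DD) [DL DM].
by split=> [c x y|x y]; rewrite -!scaleN1r ?DL ?DM.
Qed.

End Derivations.

(* What is used of the path algebra P of the quiver and of its localization A:
   keeping both abstract prevents conversion from unfolding the quotients. *)
Record presentation (k : fieldType) (Q : Type) (src tgt : Q -> 'I_2)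
    (P A : algType k) (pe : 'I_2 -> P) (py : Q -> P) (pc : 'I_2 -> P)
    (iota : P -> A) (inv : 'I_2 -> A) : Prop := Presentation {
  pres_Pind : forall T : P -> Prop,
    (forall c x y, T x -> T y -> T (c *: x + y)) ->
    (forall x y, T x -> T y -> T (x * y)) ->
    (forall s, T (pe s)) -> (forall q, T (py q)) -> forall u, T u;
  pres_Phom : forall (C : algType k) (E : 'I_2 -> C) (Y : Q -> C),
    orthogonal_idempotents E -> (forall q, Y q = E (tgt q) * Y q * E (src q)) ->
    exists F : P -> C, [/\ alg_morphism F,
      forall s, F (pe s) = E s & forall q, F (py q) = Y q];
  pres_orth : orthogonal_idempotents pe;
  pres_arrow : forall q, py q = pe (tgt q) * py q * pe (src q);
  pres_cont : forall s, pc s = pe s * pc s * pe s;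
  pres_iota : alg_morphism iota;
  pres_Aind : forall T : A -> Prop,
    (forall c x y, T x -> T y -> T (c *: x + y)) ->
    (forall x y, T x -> T y -> T (x * y)) ->
    (forall s, T (iota (pe s))) -> (forall q, T (iota (py q))) ->
    (forall s, T (iota (pc s)) -> T (inv s)) -> forall u, T u;
  pres_Ahom : forall (C : algType k) (F : P -> C) (J : 'I_2 -> C),
    alg_morphism F -> (forall s, J s = F (pe s) * J s * F (pe s)) ->
    (forall s, F (pc s) * J s = F (pe s)) ->
    (forall s, J s * F (pc s) = F (pe s)) ->
    exists G : A -> C, [/\ alg_morphism G, forall x, G (iota x) = F x
      & forall s, G (inv s) = J s];
  pres_inv : forall s, inv s = iota (pe s) * inv s * iota (pe s);
  pres_invr : forall s, iota (pc s) * inv s = iota (pe s);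
  pres_invl : forall s, inv s * iota (pc s) = iota (pe s) }.

(** * Derivations with prescribed values on the arrows *)

Section PresentedDerivations.
Variables (k : fieldType) (Q : Type) (src tgt : Q -> 'I_2) (P A : algType k).
Variables (pe : 'I_2 -> P) (py : Q -> P) (pc : 'I_2 -> P).
Variables (iota : P -> A) (inv : 'I_2 -> A).
Hypothesis pr : presentation src tgt pe py pc iota inv.
Local Notation e s := (iota (pe s)).
Local Notation y q := (iota (py q)).
Local Notation cont s := (iota (pc s)).

Lemma pres_iotaM x z : iota (x * z) = iota x * iota z.
Proof. by have [_ -> _] := pres_iota pr. Qed.

Lemma pres_iota0 : iota 0 = 0.
Proof. by have [iL _ _] := pres_iota pr; exact: lin0 iL. Qed.

Lemma pres_iotaD x z : iota (x + z) = iota x + iota z.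
Proof. by have [iL _ _] := pres_iota pr; exact: linD iL _ _. Qed.

Lemma pres_Aorth : orthogonal_idempotents (fun s => e s).
Proof.
have [EE E1] := pres_orth pr; split=> [s t|].
  by rewrite -pres_iotaM EE; case: eqP => // _; rewrite pres_iota0.
rewrite -(big_morph iota pres_iotaD pres_iota0) E1.
by have [_ _ ->] := pres_iota pr.
Qed.

Lemma pres_idem s t : e s * e t = if s == t then e s else 0.
Proof. by have [-> _] := pres_Aorth. Qed.

Lemma pres_Aarrow q : y q = e (tgt q) * y q * e (src q).
Proof. by rewrite -!pres_iotaM -(pres_arrow pr). Qed.

Lemma pres_idem_inv s : e s * inv s = inv s.
Proof. by rewrite [in LHS](pres_inv pr) !mulrA pres_idem eqxx -(pres_inv pr). Qed.

Lemma pres_inv_idem s : inv s * e s = inv s.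
Proof. by rewrite [in LHS](pres_inv pr) -mulrA pres_idem eqxx -(pres_inv pr). Qed.

Variables (M : lmodType k) (l : A -> M -> M) (r : M -> A -> M).
Hypothesis H : bimodule l r.

Lemma derivation_exists (m : Q -> M) :
  (forall q, m q = l (e (tgt q)) (r (m q) (e (src q)))) ->
  exists D : A -> M, [/\ derivation l r D, forall s, D (e s) = 0
    & forall q, D (y q) = m q].
Proof.
move=> mE.
have EE := pres_idem; have [_ E1] := pres_Aorth.
pose C : algType k := sqzero H.
pose E s : C := (e s, 0); pose Y q : C := (y q, m q).
have Eorth : orthogonal_idempotents E.
  split=> [s t|].
    rewrite [LHS]sqzeroM /= (bimod_l0 H) (bimod_r0 H) addr0 EE /E.
    by case: eqP.
  by move: E1; rewrite !big_ord_recl !big_ord0 /E !addr0 => E1;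
    congr pair => //=; rewrite addr0.
have YE q : Y q = E (tgt q) * Y q * E (src q).
  rewrite !sqzeroM /= -pres_Aarrow (bimod_l0 H) (bimod_r0 H) add0r addr0.
  by rewrite -(bimod_lr H) -mE.
have [F [FA FE FQ]] := pres_Phom pr Eorth YE.
have [FL FM F1] := FA; have [iL iM i1] := pres_iota pr.
have F_1 x : (F x).1 = iota x.
  move: x; apply: (pres_Pind pr) => [c x y IHx IHy|x y IHx IHy|s|q].
  - by rewrite FL /= IHx IHy iL.
  - by rewrite FM sqzeroM /= IHx IHy iM.
  - by rewrite FE.
  - by rewrite FQ.
have Fc s : F (pc s) = E s * F (pc s) * E s.
  by rewrite {1}(pres_cont pr) !FM !FE.
(* The image of a continuant lies in the corner cut out by [E s], and so does its second component.
   This is what makes [J s] below a two-sided inverse relative to [E s]. *)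
have Fcl s : l (e s) (F (pc s)).2 = (F (pc s)).2.
  by rewrite {2}Fc !sqzeroM /= (bimod_l0 H) (bimod_r0 H) add0r addr0 -(bimod_lr H)
    {1}Fc !sqzeroM /= (bimod_l0 H) (bimod_r0 H) add0r addr0 -(bimod_lr H)
    -(bimod_lM H) EE eqxx.
have Fcr s : r (F (pc s)).2 (e s) = (F (pc s)).2.
  by rewrite {2}Fc !sqzeroM /= (bimod_l0 H) (bimod_r0 H) add0r addr0
    {1}Fc !sqzeroM /= (bimod_l0 H) (bimod_r0 H) add0r addr0
    -(bimod_rM H) EE eqxx.
(* The second component is the value [- x^-1 (D x) x^-1] that the Leibniz rule forces on the inverse
   of [x]. *)
pose J s : C := (inv s, - l (inv s) (r (F (pc s)).2 (inv s))).
have einv := pres_idem_inv; have inve := pres_inv_idem.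
have [] := pres_Ahom pr (J := J) FA.
- move=> s; rewrite FE !sqzeroM /= (bimod_l0 H) (bimod_r0 H) add0r addr0.
  rewrite -(pres_inv pr); congr pair; rewrite (bimod_lN H) (bimod_rN H).
  by rewrite -(bimod_lM H) einv -(bimod_lr H) -(bimod_rM H) inve.
- move=> s; rewrite FE sqzeroM /= F_1 (pres_invr pr); congr pair.
  rewrite (bimod_lN H) -(bimod_lM H) (pres_invr pr).
  by rewrite (bimod_lr H) Fcl addNr.
- move=> s; rewrite FE sqzeroM /= F_1 (pres_invl pr); congr pair.
  by rewrite (bimod_rN H) -(bimod_lr H) -(bimod_rM H) (pres_invl pr) Fcr subrr.
move=> G [[GL GM G1] GF GJ].
(* [G] is a section of the projection to [A], which turns its multiplicativity into the Leibniz rule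
   for the second component. *)
have G_1 x : (G x).1 = x.
  move: x; apply: (pres_Aind pr) => [c x y IHx IHy|x y IHx IHy|s|q|s _].
  - by rewrite GL /= IHx IHy.
  - by rewrite GM sqzeroM /= IHx IHy.
  - by rewrite GF F_1.
  - by rewrite GF F_1.
  - by rewrite GJ.
exists (fun x => (G x).2); split=> [|s|q].
- by split=> [c x y|x y]; rewrite ?GL // GM sqzeroM /= !G_1.
- by rewrite GF FE.
- by rewrite GF FQ.
Qed.

Lemma derivation_eq0 (D : A -> M) : derivation l r D ->
  (forall s, D (e s) = 0) -> (forall q, D (y q) = 0) ->
  forall x, D x = 0.
Proof.
move=> [DL DM] De Dq.
apply: (pres_Aind pr) => [c x y Dx Dy|x y Dx Dy|s|q|s Dx] //.
- by rewrite DL Dx Dy scaler0 addr0.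
- by rewrite DM Dx Dy (bimod_l0 H) (bimod_r0 H) addr0.
have inve := pres_inv_idem s.
(* [D (x^-1 x) = 0] and [D x = 0] give [D (x^-1) x = 0]. Multiplying by [x^-1] on the right leaves
   [D (x^-1)] times the idempotent, which is [D (x^-1)]. *)
have := DM (inv s) (cont s).
rewrite (pres_invl pr) De Dx (bimod_l0 H) add0r => /(congr1 (r^~ (inv s))).
rewrite (bimod_r0 H) -(bimod_rM H) (pres_invr pr) => rD.
by rewrite -inve DM De -rD (bimod_l0 H) add0r.
Qed.

Lemma derivation_ext (D D' : A -> M) :
  derivation l r D -> derivation l r D' ->
  (forall s, D (e s) = D' (e s)) ->
  (forall q, D (y q) = D' (y q)) ->
  forall x, D x = D' x.
Proof.
move=> dD dD' De Dq x; apply/eqP; rewrite -subr_eq0; apply/eqP; move: x.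
by apply: derivation_eq0 => [|s|q]; rewrite ?De ?Dq ?subrr //;
  exact: derivationB.
Qed.

End PresentedDerivations.

(** * Tensor products *)

(* Locked copies of the tensor operations: conversion must not unfold the
   quotient construction when it compares two tensors. *)
HB.lock Definition otimes (k : fieldType) (U V : lmodType k) (u : U) (v : V) :
  tensor U V := tens u v.
HB.lock Definition outl (k : fieldType) (A : algType k) (x : A)
  (t : tensor A A) : tensor A A := outerl x t.
HB.lock Definition outr (k : fieldType) (A : algType k) (t : tensor A A)
  (y : A) : tensor A A := outerr t y.
HB.lock Definition innl (k : fieldType) (A : algType k) (x : A)
  (t : tensor A A) : tensor A A := tlift (fun u v => tens u (x * v)) t.
HB.lock Definition innr (k : fieldType) (A : algType k) (t : tensor A A)
  (y : A) : tensor A A := tlift (fun u v => tens (u * y) v) t.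
HB.lock Definition flip (k : fieldType) (A : algType k) (t : tensor A A) :
  tensor A A := tau12 t.
HB.lock Definition out3l (k : fieldType) (A : algType k) (x : A)
  (t : tensor (tensor A A) A) : tensor (tensor A A) A :=
  tlift (fun s z => tens (outerl x s) z) t.
HB.lock Definition out3r (k : fieldType) (A : algType k)
  (t : tensor (tensor A A) A) (y : A) : tensor (tensor A A) A :=
  tlift (fun s z => tens s (z * y)) t.
HB.lock Definition rot123 (k : fieldType) (A : algType k)
  (t : tensor (tensor A A) A) : tensor (tensor A A) A := tau123 t.
HB.lock Definition rot132 (k : fieldType) (A : algType k)
  (t : tensor (tensor A A) A) : tensor (tensor A A) A := tau132 t.

Notation "u \ox v" := (otimes u v) (at level 38, left associativity).

Section Tensors.
Variables (k : fieldType) (U V W : lmodType k).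

Lemma otimes_linl (v : V) : linear (fun u : U => u \ox v).
Proof. by move=> c u u'; rewrite !otimes.unlock (tens_bilinear _ _).1. Qed.

Lemma otimes_linr (u : U) : linear (@otimes k U V u).
Proof. by move=> c v v'; rewrite !otimes.unlock (tens_bilinear _ _).2. Qed.

HB.instance Definition _ (u : U) :=
  GRing.isLinear.Build k V (tensor U V) *:%R (otimes u) (otimes_linr u).

Lemma otimesDl (u u' : U) (v : V) : (u + u') \ox v = u \ox v + u' \ox v.
Proof. exact: linD (otimes_linl v) _ _. Qed.
Lemma otimesDr (u : U) (v v' : V) : u \ox (v + v') = u \ox v + u \ox v'.
Proof. exact: linD (otimes_linr u) _ _. Qed.
Lemma otimes0l (v : V) : (0 : U) \ox v = 0.
Proof. exact: lin0 (otimes_linl v). Qed.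
Lemma otimes0r (u : U) : u \ox (0 : V) = 0.
Proof. exact: lin0 (otimes_linr u). Qed.
Lemma otimesZl c (u : U) (v : V) : (c *: u) \ox v = c *: (u \ox v).
Proof. exact: linZ (otimes_linl v) _ _. Qed.
Lemma otimesZr c (u : U) (v : V) : u \ox (c *: v) = c *: (u \ox v).
Proof. exact: linZ (otimes_linr u) _ _. Qed.
Lemma tensor_ext (f g : tensor U V -> W) : linear f -> linear g ->
  (forall u v, f (u \ox v) = g (u \ox v)) -> f =1 g.
Proof.
move=> fL gL fg; elim/tens_ind=> [u v||c s t IHs IHt].
- by have := fg u v; rewrite otimes.unlock.
- by rewrite (lin0 fL) (lin0 gL).
- by rewrite fL gL IHs IHt.
Qed.

End Tensors.

Section TensorMaps.
Variables (k : fieldType) (A : algType k).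
Local Notation AA := (tensor A A).
Local Notation AAA := (tensor AA A).
Implicit Types (x y z u v : A).

Let tl := (tens_bilinear A A).1.
Let tr := (tens_bilinear A A).2.
Let tl3 := (tens_bilinear AA A).1.
Let tr3 := (tens_bilinear AA A).2.

Let bil_outl x : bilinear_fun (fun u v => tens (x * u) v).
Proof. by split=> *; rewrite ?mulrDr -?scalerAr ?tl ?tr. Qed.
Let bil_outr x : bilinear_fun (fun u v => tens u (v * x)).
Proof. by split=> *; rewrite ?mulrDl -?scalerAl ?tl ?tr. Qed.
Let bil_innl x : bilinear_fun (fun u v => tens u (x * v)).
Proof. by split=> *; rewrite ?mulrDr -?scalerAr ?tl ?tr. Qed.
Let bil_innr x : bilinear_fun (fun u v => tens (u * x) v).
Proof. by split=> *; rewrite ?mulrDl -?scalerAl ?tl ?tr. Qed.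
Let bil_flip : bilinear_fun (fun u v => tens v u).
Proof. by split=> *; rewrite ?tl ?tr. Qed.

Fact outl_linear x : linear (@outl k A x).
Proof. by rewrite outl.unlock; exact: tlift_linear (bil_outl x). Qed.
Fact outr_linear x : linear ((@outr k A)^~ x).
Proof. by rewrite outr.unlock; exact: tlift_linear (bil_outr x). Qed.
Fact innl_linear x : linear (@innl k A x).
Proof. by rewrite innl.unlock; exact: tlift_linear (bil_innl x). Qed.
Fact innr_linear x : linear ((@innr k A)^~ x).
Proof. by rewrite innr.unlock; exact: tlift_linear (bil_innr x). Qed.
Fact flip_linear : linear (@flip k A).
Proof. by rewrite flip.unlock; exact: tlift_linear bil_flip. Qed.

Lemma outl_tens x u v : outl x (u \ox v) = (x * u) \ox v.
Proof. by rewrite outl.unlock otimes.unlock outerl_tens. Qed.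
Lemma outr_tens u v y : outr (u \ox v) y = u \ox (v * y).
Proof. by rewrite outr.unlock otimes.unlock outerr_tens. Qed.
Lemma innl_tens x u v : innl x (u \ox v) = u \ox (x * v).
Proof. by rewrite innl.unlock otimes.unlock (tlift_tens (bil_innl x)). Qed.
Lemma innr_tens u v y : innr (u \ox v) y = (u * y) \ox v.
Proof. by rewrite innr.unlock otimes.unlock (tlift_tens (bil_innr y)). Qed.
Lemma flip_tens u v : flip (u \ox v) = v \ox u.
Proof. by rewrite flip.unlock otimes.unlock tau12_tens. Qed.

Let bil_out3l x : bilinear_fun (fun (s : AA) z => tens (outerl x s) z).
Proof.
have oL := outl_linear x; rewrite outl.unlock in oL.
by split=> *; rewrite ?oL ?tl3 ?tr3.
Qed.
Let bil_out3r x : bilinear_fun (fun (s : AA) z => tens s (z * x)).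
Proof. by split=> *; rewrite ?mulrDl -?scalerAl ?tl3 ?tr3. Qed.

Fact out3l_linear x : linear (@out3l k A x).
Proof. by rewrite out3l.unlock; exact: tlift_linear (bil_out3l x). Qed.
Fact out3r_linear x : linear ((@out3r k A)^~ x).
Proof. by rewrite out3r.unlock; exact: tlift_linear (bil_out3r x). Qed.

Lemma out3l_tens x (s : AA) z : out3l x (s \ox z) = outl x s \ox z.
Proof.
by rewrite out3l.unlock outl.unlock otimes.unlock (tlift_tens (bil_out3l x)).
Qed.
Lemma out3r_tens (s : AA) z y : out3r (s \ox z) y = s \ox (z * y).
Proof. by rewrite out3r.unlock otimes.unlock (tlift_tens (bil_out3r y)). Qed.

Let tau_linear (f : A -> A -> A -> AAA) :
  (forall c x x' y z, f (c *: x + x') y z = c *: f x y z + f x' y z) ->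
  (forall c x y y' z, f x (c *: y + y') z = c *: f x y z + f x y' z) ->
  (forall c x y z z', f x y (c *: z + z') = c *: f x y z + f x y z') ->
  linear (tlift (fun (s : AA) x3 => tlift (fun x1 x2 => f x1 x2 x3) s)).
Proof.
move=> f1 f2 f3.
have fb x3 : bilinear_fun (fun x1 x2 => f x1 x2 x3) by split.
have fL x3 : linear (tlift (fun x1 x2 => f x1 x2 x3)).
  exact: tlift_linear (fb x3).
apply: tlift_linear; split=> [c s s' x3|c s x3 x3']; first exact: fL.
move: s; apply: (@tensor_ext k A A AAA) => [||u v]; first exact: fL.
  by apply: linear_add (fL _); apply: linear_scale (fL _).
by rewrite otimes.unlock !(tlift_tens (fb _)).
Qed.

Fact rot123_linear : linear (@rot123 k A).
Proof. by rewrite rot123.unlock; apply: tau_linear => *;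
    rewrite tens3_linear. Qed.
Fact rot132_linear : linear (@rot132 k A).
Proof. by rewrite rot132.unlock; apply: tau_linear => *;
    rewrite tens3_linear. Qed.

Lemma rot123_tens u v z : rot123 (u \ox v \ox z) = z \ox u \ox v.
Proof. by rewrite rot123.unlock otimes.unlock; exact: tau123_tens3. Qed.
Lemma rot132_tens u v z : rot132 (u \ox v \ox z) = v \ox z \ox u.
Proof. by rewrite rot132.unlock otimes.unlock; exact: tau132_tens3. Qed.

HB.instance Definition _ x :=
  GRing.isLinear.Build k AA AA *:%R (outl x) (outl_linear x).
HB.instance Definition _ x :=
  GRing.isLinear.Build k AA AA *:%R (innl x) (innl_linear x).
HB.instance Definition _ :=
  GRing.isLinear.Build k AA AA *:%R (@flip k A) flip_linear.
HB.instance Definition _ x :=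
  GRing.isLinear.Build k AAA AAA *:%R (out3l x) (out3l_linear x).
HB.instance Definition _ :=
  GRing.isLinear.Build k AAA AAA *:%R (@rot123 k A) rot123_linear.
HB.instance Definition _ :=
  GRing.isLinear.Build k AAA AAA *:%R (@rot132 k A) rot132_linear.

Lemma bimodule_outer : bimodule (@outl k A) (@outr k A).
Proof.
split=> [x|m|x|m|m|m|x y m|x y m|x y m].
- exact: outl_linear.
- move=> c x y; move: m; apply: tensor_ext; first exact: outl_linear.
    by apply/linear_add/outl_linear/linear_scale/outl_linear.
  by move=> u v; rewrite !outl_tens mulrDl -scalerAl otimesDl otimesZl.
- exact: outr_linear.
- move=> c x y; move: m; apply: tensor_ext; first exact: outr_linear.
    by apply/linear_add/outr_linear/linear_scale/outr_linear.
  by move=> u v; rewrite !outr_tens mulrDr -scalerAr linearP.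
- move: m; apply: tensor_ext; [exact: outl_linear|exact: linear_id|].
  by move=> u v; rewrite outl_tens mul1r.
- move: m; apply: tensor_ext; [exact: outr_linear|exact: linear_id|].
  by move=> u v; rewrite outr_tens mulr1.
- move: m; apply: tensor_ext; first exact: outl_linear.
    by apply/linear_comp/outl_linear/outl_linear.
  by move=> u v; rewrite !outl_tens mulrA.
- move: m; apply: tensor_ext; first exact: outr_linear.
    by apply: (linear_comp (outr_linear y)); exact: outr_linear.
  by move=> u v; rewrite !outr_tens mulrA.
- move: m; apply: tensor_ext.
  + by apply: (linear_comp (outl_linear x)); exact: outr_linear.
  + by apply: (linear_comp (outr_linear y)); exact: outl_linear.
  by move=> u v; rewrite outr_tens !outl_tens outr_tens.
Qed.

Lemma bimodule_inner : bimodule (@innl k A) (@innr k A).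
Proof.
split=> [x|m|x|m|m|m|x y m|x y m|x y m].
- exact: innl_linear.
- move=> c x y; move: m; apply: tensor_ext; first exact: innl_linear.
    by apply/linear_add/innl_linear/linear_scale/innl_linear.
  by move=> u v; rewrite !innl_tens mulrDl -scalerAl linearP.
- exact: innr_linear.
- move=> c x y; move: m; apply: tensor_ext; first exact: innr_linear.
    by apply/linear_add/innr_linear/linear_scale/innr_linear.
  by move=> u v; rewrite !innr_tens mulrDr -scalerAr otimesDl otimesZl.
- move: m; apply: tensor_ext; [exact: innl_linear|exact: linear_id|].
  by move=> u v; rewrite innl_tens mul1r.
- move: m; apply: tensor_ext; [exact: innr_linear|exact: linear_id|].
  by move=> u v; rewrite innr_tens mulr1.
- move: m; apply: tensor_ext; first exact: innl_linear.
    by apply/linear_comp/innl_linear/innl_linear.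
  by move=> u v; rewrite !innl_tens mulrA.
- move: m; apply: tensor_ext; first exact: innr_linear.
    by apply: (linear_comp (innr_linear y)); exact: innr_linear.
  by move=> u v; rewrite !innr_tens mulrA.
- move: m; apply: tensor_ext.
  + by apply: (linear_comp (innl_linear x)); exact: innr_linear.
  + by apply: (linear_comp (innr_linear y)); exact: innl_linear.
  by move=> u v; rewrite innr_tens !innl_tens innr_tens.
Qed.

Lemma bimodule_outer3 : bimodule (@out3l k A) (@out3r k A).
Proof.
split=> [x|m|x|m|m|m|x y m|x y m|x y m].
- exact: out3l_linear.
- move=> c x y; move: m; apply: tensor_ext; first exact: out3l_linear.
    by apply/linear_add/out3l_linear/linear_scale/out3l_linear.
  move=> u v; rewrite !out3l_tens (bimod_linl1 bimodule_outer).
  by rewrite otimesDl otimesZl.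
- exact: out3r_linear.
- move=> c x y; move: m; apply: tensor_ext; first exact: out3r_linear.
    by apply/linear_add/out3r_linear/linear_scale/out3r_linear.
  by move=> u v; rewrite !out3r_tens mulrDr -scalerAr linearP.
- move: m; apply: tensor_ext; [exact: out3l_linear|exact: linear_id|].
  by move=> u v; rewrite out3l_tens (bimod_l1 bimodule_outer).
- move: m; apply: tensor_ext; [exact: out3r_linear|exact: linear_id|].
  by move=> u v; rewrite out3r_tens mulr1.
- move: m; apply: tensor_ext; first exact: out3l_linear.
    by apply/linear_comp/out3l_linear/out3l_linear.
  by move=> u v; rewrite !out3l_tens (bimod_lM bimodule_outer).
- move: m; apply: tensor_ext; first exact: out3r_linear.
    by apply: (linear_comp (out3r_linear y)); exact: out3r_linear.
  by move=> u v; rewrite !out3r_tens mulrA.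
- move: m; apply: tensor_ext.
  + by apply: (linear_comp (out3l_linear x)); exact: out3r_linear.
  + by apply: (linear_comp (out3r_linear y)); exact: out3l_linear.
  by move=> u v; rewrite out3r_tens !out3l_tens out3r_tens.
Qed.

(** All four actions on [A \ox A] commute across the two structures. Putting 1 for some of the
    arguments isolates the commutation of a single pair. *)
Lemma inner_outer_comm x y z w (t : AA) :
  innl x (innr (outl y (outr t z)) w)
    = outl y (outr (innl x (innr t w)) z).
Proof.
move: t; apply: tensor_ext.
- apply: (linear_comp (innl_linear x)); apply: (linear_comp (innr_linear w)).
  by apply: (linear_comp (outl_linear y)); exact: outr_linear.
- apply: (linear_comp (outl_linear y)); apply: (linear_comp (outr_linear z)).
  by apply: (linear_comp (innl_linear x)); exact: innr_linear.
by move=> u v; rewrite outr_tens outl_tens !innr_tens !innl_tens outr_tens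
    outl_tens !mulrA.
Qed.

End TensorMaps.


(** * Double brackets *)

Section DoubleBrackets.
Variables (k : fieldType) (A : algType k) (e : 'I_2 -> A).
Local Notation AA := (tensor A A).
Variable db : A -> A -> AA.

(** Linearity and the Leibniz rule in the first argument follow by antisymmetry, since the flip
    exchanges the outer structure with the inner one. *)
Definition antisymmetric_biderivation : Prop :=
  [/\ forall a, derivation (@outl k A) (@outr k A) (db a),
      forall a b, db a b = - flip (db b a) & forall a s, db a (e s) = 0].

Lemma double_bracketP : double_bracket e db <-> antisymmetric_biderivation.
Proof.
split=> [[[dbL dbR] dbN dbM dbe]|[dbD dbN dbe]].
  split=> [a|a b|a s].
  - split=> [c x y|b c]; first exact: dbR.
    by rewrite outl.unlock outr.unlock addrC.
  - by rewrite flip.unlock.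
  - have := dbe a (fun t => (t == s)%:R); rewrite (bigD1 s) //= eqxx scale1r.
    by rewrite big1 ?addr0 // => t /negPf->; rewrite scale0r.
split=> [|a b|a b c|a c].
- have dbR a : linear (db a) by have [] := dbD a.
  split=> [c a a' b|c a b b']; last exact: dbR.
  by rewrite dbN dbR linearP /= opprD -scalerN -!dbN.
- by rewrite dbN flip.unlock.
- have [_ dbM] := dbD a; move: (dbM b c).
  by rewrite outl.unlock outr.unlock => ->; exact: addrC.
- have [dbL _] := dbD a.
  rewrite (big_morph (db a) (linD dbL) (lin0 dbL)) big1 // => s _.
  by rewrite (linZ dbL) dbe scaler0.
Qed.

Hypothesis dbP : antisymmetric_biderivation.

Lemma db_outer a : derivation (@outl k A) (@outr k A) (db a).
Proof. by case: dbP. Qed.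
Lemma dbC a b : db a b = - flip (db b a).
Proof. by case: dbP. Qed.
Lemma db_idem a s : db a (e s) = 0.
Proof. by case: dbP. Qed.
Lemma db_lin a : linear (db a).
Proof. by case: (db_outer a). Qed.
Lemma dbM a b c : db a (b * c) = outl b (db a c) + outr (db a b) c.
Proof. by have [_ ->] := db_outer a. Qed.

Lemma db_linl b : linear (db^~ b).
Proof. by move=> c x y; rewrite dbC db_lin linearP /= opprD -scalerN -!dbC. Qed.

Lemma db_idem_l s b : db (e s) b = 0.
Proof. by rewrite dbC db_idem linear0 oppr0. Qed.

Lemma flip_outl x (t : AA) : flip (outl x t) = innl x (flip t).
Proof.
move: t; apply: tensor_ext.
- exact/linear_comp/outl_linear/flip_linear.
- exact/linear_comp/flip_linear/innl_linear.
by move=> u v; rewrite outl_tens !flip_tens innl_tens.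
Qed.

Lemma flip_outr x (t : AA) : flip (outr t x) = innr (flip t) x.
Proof.
move: t; apply: tensor_ext.
- exact/(linear_comp (@flip_linear k A))/outr_linear.
- exact/(linear_comp (innr_linear x))/flip_linear.
by move=> u v; rewrite outr_tens !flip_tens innr_tens.
Qed.

Lemma flip_innl x (t : AA) : flip (innl x t) = outl x (flip t).
Proof.
move: t; apply: tensor_ext.
- exact/linear_comp/innl_linear/flip_linear.
- exact/linear_comp/flip_linear/outl_linear.
by move=> u v; rewrite innl_tens !flip_tens outl_tens.
Qed.

Lemma flip_innr x (t : AA) : flip (innr t x) = outr (flip t) x.
Proof.
move: t; apply: tensor_ext.
- exact/(linear_comp (@flip_linear k A))/innr_linear.
- exact/(linear_comp (outr_linear x))/flip_linear.
by move=> u v; rewrite innr_tens !flip_tens outr_tens.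
Qed.

Lemma dbMl a b c : db (a * b) c = innl a (db b c) + innr (db a c) b.
Proof.
rewrite dbC dbM linearD /= flip_outl flip_outr opprD -linearN /= -dbC.
by rewrite -(bimod_rN (@bimodule_inner k A)) -dbC.
Qed.

Lemma db_inner b : derivation (@innl k A) (@innr k A) (db^~ b).
Proof. by split=> [|x y]; [exact: db_linl | exact: dbMl]. Qed.

End DoubleBrackets.

(** * Double brackets with prescribed values on the arrows *)

Section BracketOfValues.
Variables (k : fieldType) (Q : Type) (src tgt : Q -> 'I_2) (P A : algType k).
Variables (pe : 'I_2 -> P) (py : Q -> P) (pc : 'I_2 -> P).
Variables (iota : P -> A) (inv : 'I_2 -> A).
Hypothesis pr : presentation src tgt pe py pc iota inv.
Local Notation e s := (iota (pe s)).
Local Notation y q := (iota (py q)).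
Local Notation AA := (tensor A A).
Let biO := @bimodule_outer k A.
Let biI := @bimodule_inner k A.

Lemma bracket_unique (db db' : A -> A -> AA) :
  antisymmetric_biderivation (fun s => e s) db ->
  antisymmetric_biderivation (fun s => e s) db' ->
  (forall p q, db (y p) (y q) = db' (y p) (y q)) ->
  forall a b, db a b = db' a b.
Proof.
move=> H H' E a b; move: a; apply: (derivation_ext pr biI).
- exact: db_inner H b.
- exact: db_inner H' b.
- by move=> s; rewrite (db_idem_l H) (db_idem_l H').
move=> p; move: b; apply: (derivation_ext pr biO); last exact: E.
- exact: db_outer H _.
- exact: db_outer H' _.
- by move=> s; rewrite (db_idem H) (db_idem H').
Qed.

Variable beta : Q -> Q -> AA.
Hypothesis betaC : forall p q, beta p q = - flip (beta q p).
Hypothesis beta_typed : forall p q,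
  beta p q = outl (e (tgt q)) (outr (beta p q) (e (src q))).

(** The second argument is extended first, with an arrow in the first one ([D]), and then the first
    argument ([I]). The Leibniz rule of the result in its second argument and its antisymmetry are
    equalities of inner derivations of the first argument, so they can be checked on arrows. *)
Lemma bracket_exists : exists db : A -> A -> AA,
  antisymmetric_biderivation (fun s => e s) db
  /\ forall p q, db (y p) (y q) = beta p q.
Proof.
have exD p : exists D : A -> AA, [/\ derivation (@outl k A) (@outr k A) D,
    forall s, D (e s) = 0 & forall q, D (y q) = beta p q].
  by apply: (derivation_exists pr biO); exact: beta_typed.
have [D DP] := choice exD.
have DL p : linear (D p) by have [[]] := DP p.
have DM p a b : D p (a * b) = outl a (D p b) + outr (D p a) b.
  by have [[_ ->]] := DP p.
have De p s : D p (e s) = 0 by have [_ ->] := DP p.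
have Dy p q : D p (y q) = beta p q by have [_ _ ->] := DP p.
(* Antisymmetry carries the typing condition over from the second argument to the first. *)
have beta_typedl p q :
    beta p q = innl (e (tgt p)) (innr (beta p q) (e (src p))).
  rewrite [LHS]betaC [X in flip X]beta_typed flip_outl flip_outr -linearN /=.
  by rewrite -(bimod_rN biI) -betaC.
(* The second extension takes [D p b] as the value at the arrow [p], so the typing is needed for
   every [b] and not only for arrows. It spreads from the arrows because the inner action by
   idempotents commutes with the outer Leibniz rule. *)
have D_typed p b : D p b = innl (e (tgt p)) (innr (D p b) (e (src p))).
  move: b; apply: (derivation_ext pr biO) => [||s|q]; first by have [] := DP p.
  - split=> [c a b|a b].
      by rewrite DL (innr_linear _) linearP.
    rewrite DM (bimod_rD biI) linearD /=.
    have := inner_outer_comm (e (tgt p)) a 1 (e (src p)) (D p b).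
    rewrite !(bimod_r1 biO) => ->.
    have := inner_outer_comm (e (tgt p)) 1 b (e (src p)) (D p a).
    by rewrite !(bimod_l1 biO) => ->.
  - by rewrite De (bimod_r0 biI) linear0.
  - by rewrite Dy -beta_typedl.
have exI b : exists I : A -> AA, [/\ derivation (@innl k A) (@innr k A) I,
    forall s, I (e s) = 0 & forall p, I (y p) = D p b].
  by apply: (derivation_exists pr biI) => p; exact: D_typed.
have [I IP] := choice exI.
have II b : derivation (@innl k A) (@innr k A) (I b) by have [] := IP b.
have IL b : linear (I b) by have [[]] := IP b.
have IM b a a' : I b (a * a') = innl a (I b a') + innr (I b a) a'.
  by have [[_ ->]] := IP b.
have Ie b s : I b (e s) = 0 by have [_ ->] := IP b.
have Iy b p : I b (y p) = D p b by have [_ _ ->] := IP b.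
have dI a : derivation (@outl k A) (@outr k A) (fun b => I b a).
  split=> [c b b'|b b']; move: a; apply: (derivation_ext pr biI) => //.
  - apply: (derivationD biI); last exact: II.
    by apply: (derivationZ biI); exact: II.
  - by move=> s; rewrite !Ie scaler0 addr0.
  - by move=> p; rewrite !Iy DL.
  - split=> [c a a'|a a'].
      rewrite !IL linearP (outr_linear _) scalerDr.
      by rewrite addrACA.
    (* Expanding [{{a a', b b'}}] in the two orders gives four terms each. They match in pairs by
       the commutation of one inner with one outer action. *)
    rewrite !IM linearD (bimod_rD biO) (bimod_rD biI) linearD /=.
    have := inner_outer_comm a b 1 1 (I b' a').
    rewrite !(bimod_r1 biO) !(bimod_r1 biI) => ->.
    have := inner_outer_comm 1 b 1 a' (I b' a).
    rewrite !(bimod_r1 biO) !(bimod_l1 biI) => ->.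
    have := inner_outer_comm a 1 b' 1 (I b a').
    rewrite !(bimod_l1 biO) !(bimod_r1 biI) => ->.
    have := inner_outer_comm 1 1 b' a' (I b a).
    rewrite !(bimod_l1 biO) !(bimod_l1 biI) => ->.
    by rewrite addrACA.
  - by move=> s; rewrite !Ie linear0 (bimod_r0 biO) addr0.
  - by move=> p; rewrite !Iy DM.
exists (fun a b => I b a); split=> [|p q]; last by rewrite Iy Dy.
have Ie_l b s : I (e s) b = 0.
  by move: b; apply: (derivation_eq0 pr biI) => // p; rewrite Iy De.
split=> // a b; move: a; apply: (derivation_ext pr biI) => //.
- have [L M] := dI b; split=> [c a a'|a a'].
    by rewrite L linearP /= opprD scalerN.
  rewrite M linearD /= flip_outl flip_outr opprD -linearN /=.
  by rewrite -(bimod_rN biI).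
- by move=> s; rewrite Ie_l Ie linear0 oppr0.
move=> p; rewrite Iy; move: b.
apply: (derivation_ext pr biO (D := D p) (D' := fun b => - flip (I (y p) b))).
- by have [dD _ _] := DP p; exact: dD.
- split=> [c b b'|b b'].
    by rewrite (IL (y p)) linearP /= opprD scalerN.
  rewrite (IM (y p)) linearD /= opprD flip_innl flip_innr -linearN /=.
  by rewrite -(bimod_rN biO).
- by move=> s; rewrite De Ie linear0 oppr0.
by move=> q; rewrite Iy !Dy.
Qed.

End BracketOfValues.

(** * Equality of linear combinations *)

Section LinearCombinations.
Variables (k : fieldType) (V : lmodType k).

Inductive mexp : Type :=
| MZero | MAtom of nat | MAdd of mexp & mexp | MOpp of mexp | MScale of k & mexp.

Fixpoint mval (env : seq V) (t : mexp) : V :=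
  match t with
  | MZero => 0
  | MAtom i => nth 0 env i
  | MAdd t u => mval env t + mval env u
  | MOpp t => - mval env t
  | MScale c t => c *: mval env t
  end.

(** [Nat.eqb] reduces under the short unfolding list of [cbv] in [lincomb], which thus computes the
    coefficients without unfolding the operations of [k]. *)
Fixpoint mcoef (i : nat) (t : mexp) : k :=
  match t with
  | MZero => 0
  | MAtom j => if Nat.eqb i j then 1 else 0
  | MAdd t u => mcoef i t + mcoef i u
  | MOpp t => - mcoef i t
  | MScale c t => c * mcoef i t
  end.

Fixpoint mcoef_eq (n : nat) (t u : mexp) : Prop :=
  if n is n'.+1 then mcoef n' t = mcoef n' u /\ mcoef_eq n' t u else True.

Lemma mvalE env t : mval env t = \sum_(i < size env) mcoef i t *: env`_i.
Proof.
elim: t => [|j|t IHt u IHu|t IHt|c t IHt] /=.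
- by rewrite big1 // => i _; rewrite scale0r.
- have [lt|ge] := ltnP j (size env).
    rewrite (bigD1 (Ordinal lt)) //= PeanoNat.Nat.eqb_refl scale1r.
    rewrite big1 ?addr0 // => i /eqP ne.
    case: (PeanoNat.Nat.eqb_spec i j) => [E|_]; last exact: scale0r.
    by case: ne; apply: val_inj.
  rewrite nth_default // big1 // => i _.
  case: (PeanoNat.Nat.eqb_spec i j) => [E|_]; last exact: scale0r.
  by have := ltn_ord i; rewrite E ltnNge ge.
- by rewrite IHt IHu -big_split; apply: eq_bigr => i _; rewrite scalerDl.
- by rewrite IHt -sumrN; apply: eq_bigr => i _; rewrite scaleNr.
- by rewrite IHt scaler_sumr; apply: eq_bigr => i _; rewrite scalerA.
Qed.

Lemma mval_eq env t u : mcoef_eq (size env) t u -> mval env t = mval env u.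
Proof.
rewrite !mvalE => H; apply: eq_bigr => i _; congr (_ *: _).
elim: (size env) i H => [|n IH] i /= []; first by case: i.
move=> En H; have := ltn_ord i; rewrite ltnS leq_eqVlt => /orP[/eqP->//|lt].
exact: (IH (Ordinal lt) H).
Qed.

End LinearCombinations.

Arguments MZero {k}.
Arguments MAtom {k} _.

Ltac lc_mem x l :=
  lazymatch l with
  | nil => false
  | cons ?y ?l' =>
      match constr:(Set) with
      | _ => let _ := match constr:(Set) with _ => constr_eq x y end in true
      | _ => lc_mem x l'
      end
  end.
Ltac lc_index x l :=
  lazymatch l with
  | cons ?y ?l' =>
      match constr:(Set) with
      | _ => let _ := match constr:(Set) with _ => constr_eq x y end in constr:(O)
      | _ => let i := lc_index x l' in constr:(S i)
      end
  end.
Ltac lc_atoms t l :=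
  lazymatch t with
  | (?a + ?b)%R => let l' := lc_atoms a l in lc_atoms b l'
  | (- ?a)%R => lc_atoms a l
  | (_ *: ?a)%R => lc_atoms a l
  | 0%R => l
  | _ => let b := lc_mem t l in
         lazymatch b with true => l | false => constr:(cons t l) end
  end.
Ltac lc_quote k t l :=
  lazymatch t with
  | (?a + ?b)%R => let a' := lc_quote k a l in let b' := lc_quote k b l in
                   constr:(@MAdd k a' b')
  | (- ?a)%R => let a' := lc_quote k a l in constr:(@MOpp k a')
  | (?c *: ?a)%R => let a' := lc_quote k a l in constr:(@MScale k c a')
  | 0%R => constr:(@MZero k)
  | _ => let i := lc_index t l in constr:(@MAtom k i)
  end.
(* Atoms are compared syntactically, coefficients with [ring]. *)
Ltac lincomb k V :=
  lazymatch goal with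
  | |- ?x = ?y =>
      let l0 := lc_atoms x (@nil (GRing.Lmodule.sort V)) in
      let l := lc_atoms y l0 in
      let t := lc_quote k x l in
      let u := lc_quote k y l in
      let H := fresh in
      have H := @mval_eq k V l t u;
      cbv [mval nth mcoef_eq mcoef size Nat.eqb] in H;
      apply: H; repeat (split; first by ring); exact: I
  end.

(** * Triple brackets *)

(* [scalerAl] and [scalerAr] reversed, with the product in the canonical ring
   structure of A, which [lincomb] requires to recognize equal atoms. *)
Lemma alg_scalel (k : fieldType) (A : algType k) c (x y : A) :
  (c *: x) * y = c *: (x * y).
Proof. by rewrite scalerAl. Qed.
Lemma alg_scaler (k : fieldType) (A : algType k) c (x y : A) :
  x * (c *: y) = c *: (x * y).
Proof. by rewrite scalerAr. Qed.

HB.lock Definition bracketL (k : fieldType) (A : algType k) (db : A -> A ->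
    tensor A A)
  (a : A) (t : tensor A A) : tensor (tensor A A) A := dbL db a t.

(** [cross s (u \ox v)] is [(s u) \ox v] for the outer action of [u] on [s]. It is the amount by
    which the single summands of the triple bracket fail the Leibniz rule in the last argument. *)
HB.lock Definition cross (k : fieldType) (A : algType k) (s t : tensor A A) :
  tensor (tensor A A) A := tlift (fun u v => otimes (outr s u) v) t.

Section TripleBracket.
Variables (k : fieldType) (A : algType k) (e : 'I_2 -> A).
Local Notation AA := (tensor A A).
Local Notation AAA := (tensor AA A).
Variable db : A -> A -> AA.
Hypothesis dbP : antisymmetric_biderivation e db.
Let biO := @bimodule_outer k A.
Let biI := @bimodule_inner k A.
Let bi3 := @bimodule_outer3 k A.

Let bil_bracketL a : bilinear_fun (fun b c : A => tens (db a b) c).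
Proof.
split=> c u v w; last by rewrite (tens_bilinear _ _).2.
by rewrite (db_lin dbP) (tens_bilinear _ _).1.
Qed.

Lemma bracketL_linear a : linear (@bracketL k A db a).
Proof. by rewrite bracketL.unlock; exact: tlift_linear (bil_bracketL a). Qed.

HB.instance Definition _ a :=
  GRing.isLinear.Build k AA AAA *:%R (bracketL db a) (bracketL_linear a).

Lemma bracketL_tens a (u v : A) : bracketL db a (u \ox v) = db a u \ox v.
Proof. by rewrite bracketL.unlock otimes.unlock;
    exact: tlift_tens (bil_bracketL a) _ _. Qed.

Let bil_cross (s : AA) : bilinear_fun (fun u v : A => outr s u \ox v).
Proof.
split=> c u v w; last by rewrite linearP.
by rewrite (bimod_linr1 biO) (otimes_linl _).
Qed.

Lemma cross_linear s : linear (@cross k A s).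
Proof. by rewrite cross.unlock; exact: tlift_linear (bil_cross s). Qed.

Lemma cross_tens (s : AA) (u v : A) : cross s (u \ox v) = outr s u \ox v.
Proof.
have <- := tlift_tens (bil_cross s) u v.
by rewrite cross.unlock otimes.unlock.
Qed.

Lemma cross_linearl t : linear (fun s => @cross k A s t).
Proof.
move=> c s s'; move: t; apply: tensor_ext; first exact: cross_linear.
  by apply: linear_add (cross_linear _); apply: linear_scale (cross_linear _).
move=> u v; rewrite !cross_tens (bimod_linr biO).
exact: otimes_linl.
Qed.

Lemma bracketL_outr a t d : bracketL db a (outr t d) = out3r (bracketL db a t) d.
Proof.
move: t; apply: tensor_ext.
- exact: linear_comp (bracketL_linear a) (outr_linear d).
- exact: linear_comp (out3r_linear d) (bracketL_linear a).
by move=> u v; rewrite outr_tens !bracketL_tens out3r_tens.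
Qed.

Lemma bracketL_outl a c t :
  bracketL db a (outl c t) = out3l c (bracketL db a t) + cross (db a c) t.
Proof.
move: t; apply: tensor_ext.
- exact: linear_comp (bracketL_linear a) (outl_linear c).
- apply: linear_add (cross_linear _).
  exact: linear_comp (out3l_linear c) (bracketL_linear a).
move=> u v; rewrite outl_tens !bracketL_tens out3l_tens cross_tens.
by rewrite (dbM dbP) otimesDl.
Qed.

Lemma rot123_innl b c t :
  rot123 (bracketL db b (innl c t)) = out3l c (rot123 (bracketL db b t)).
Proof.
move: t; apply: tensor_ext.
- by apply: linear_comp (@rot123_linear k A) _;
    exact: linear_comp (bracketL_linear b) (innl_linear c).
- by apply: linear_comp (out3l_linear c) _;
    exact: linear_comp (@rot123_linear k A) (bracketL_linear b).
move=> u v; rewrite innl_tens !bracketL_tens; move: (db b u) => t; move: t.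
apply: tensor_ext.
- exact: linear_comp (@rot123_linear k A) (otimes_linl _).
- by apply: linear_comp (out3l_linear c) _;
    exact: linear_comp (@rot123_linear k A) (otimes_linl _).
by move=> p q; rewrite !rot123_tens out3l_tens outl_tens.
Qed.

Lemma rot123_innr b d t :
  rot123 (bracketL db b (innr t d))
    = out3r (rot123 (bracketL db b t)) d + cross (flip t) (db b d).
Proof.
move: t; apply: tensor_ext.
- by apply: linear_comp (@rot123_linear k A) _;
    exact: linear_comp (bracketL_linear b) (innr_linear d).
- apply: linear_add.
    by apply: linear_comp (out3r_linear d) _;
        exact: linear_comp (@rot123_linear k A) (bracketL_linear b).
  exact: linear_comp (cross_linearl _) (@flip_linear k A).
move=> u v; rewrite innr_tens flip_tens !bracketL_tens (dbM dbP) otimesDl linearD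
    /=.
rewrite addrC; congr (_ + _).
  move: (db b u) => t; move: t; apply: tensor_ext.
  - by apply: linear_comp (@rot123_linear k A) _;
      exact: linear_comp (otimes_linl _) (outr_linear d).
  - by apply: linear_comp (out3r_linear d) _;
      exact: linear_comp (@rot123_linear k A) (otimes_linl _).
  by move=> p q; rewrite outr_tens !rot123_tens out3r_tens.
move: (db b d) => t; move: t; apply: tensor_ext.
- by apply: linear_comp (@rot123_linear k A) _;
    exact: linear_comp (otimes_linl _) (outl_linear u).
- exact: cross_linear.
by move=> p q; rewrite outl_tens rot123_tens cross_tens outr_tens.
Qed.

Lemma rot132_bracketLM c d t :
  rot132 (bracketL db (c * d) t)
    = out3l c (rot132 (bracketL db d t)) + out3r (rot132 (bracketL db c t)) d.
Proof.
move: t; apply: tensor_ext.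
- exact: linear_comp (@rot132_linear k A) (bracketL_linear _).
- apply: linear_add.
    by apply: linear_comp (out3l_linear c) _;
        exact: linear_comp (@rot132_linear k A) (bracketL_linear _).
  by apply: linear_comp (out3r_linear d) _;
      exact: linear_comp (@rot132_linear k A) (bracketL_linear _).
move=> u v; rewrite !bracketL_tens (dbMl dbP) otimesDl linearD /=; congr (_ + _).
  move: (db d u) => t; move: t; apply: tensor_ext.
  - by apply: linear_comp (@rot132_linear k A) _;
      exact: linear_comp (otimes_linl _) (innl_linear c).
  - by apply: linear_comp (out3l_linear c) _;
      exact: linear_comp (@rot132_linear k A) (otimes_linl _).
  by move=> p q; rewrite innl_tens !rot132_tens out3l_tens outl_tens.
move: (db c u) => t; move: t; apply: tensor_ext.
- by apply: linear_comp (@rot132_linear k A) _;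
    exact: linear_comp (otimes_linl _) (innr_linear d).
- by apply: linear_comp (out3r_linear d) _;
    exact: linear_comp (@rot132_linear k A) (otimes_linl _).
by move=> p q; rewrite innr_tens !rot132_tens out3r_tens.
Qed.

Lemma bracketL_linearl t : linear (fun a => bracketL db a t).
Proof.
move=> c a a'; move: t; apply: tensor_ext; first exact: bracketL_linear.
  by apply: linear_add (bracketL_linear _);
      apply: linear_scale (bracketL_linear _).
by move=> u v; rewrite !bracketL_tens (db_linl dbP) (otimes_linl _).
Qed.

Lemma bracketL_idem s t : bracketL db (e s) t = 0.
Proof.
move: t; apply: tensor_ext; first exact: bracketL_linear.
  by move=> c x y; rewrite scaler0 addr0.
by move=> u v; rewrite bracketL_tens (db_idem_l dbP) otimes0l.
Qed.

Definition triple (a b c : A) : AAA :=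
  bracketL db a (db b c) + rot123 (bracketL db b (db c a)) + rot132 (bracketL db
      c (db a b)).

(** The first summand leaves the defect [cross (db a c) (db b d)] and the second one
    [cross (flip (db c a)) (db b d)]. They are opposite by antisymmetry, and the third summand has
    no defect. *)
Lemma triple_derivation a b : derivation (@out3l k A) (@out3r k A) (triple a b).
Proof.
split=> [x c d|c d].
  move: x c d; apply: (@linear_add k A AAA
    (fun c => bracketL db a (db b c) + rot123 (bracketL db b (db c a)))
    (fun c => rot132 (bracketL db c (db a b)))).
    apply: linear_add; first exact: linear_comp (bracketL_linear a) (db_lin dbP
        b).
    apply: linear_comp (@rot123_linear k A) _.
    exact: linear_comp (bracketL_linear b) (db_linl dbP a).
  exact: linear_comp (@rot132_linear k A) (bracketL_linearl _).
rewrite /triple rot132_bracketLM (dbM dbP) (dbMl dbP) !linearD /=.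
rewrite bracketL_outl bracketL_outr rot123_innl rot123_innr.
rewrite -[flip _]opprK -(dbC dbP) (linN (@cross_linearl _)).
rewrite !(bimod_rD bi3).
by lincomb k (tensor (tensor A A) A).
Qed.

Definition quasi_Poisson_rhs (a b c : A) : AAA := \sum_s
    ((c * e s * a) \ox (e s * b) \ox (e s)
     - (c * e s * a) \ox (e s) \ox (b * e s)
     - (c * e s) \ox (a * e s * b) \ox (e s)
     + (c * e s) \ox (a * e s) \ox (b * e s)
     - (e s * a) \ox (e s * b) \ox (e s * c)
     + (e s * a) \ox (e s) \ox (b * e s * c)
     + (e s) \ox (a * e s * b) \ox (e s * c)
     - (e s) \ox (a * e s) \ox (b * e s * c)).

Lemma quasi_PoissonP : quasi_Poisson e db <->
  forall a b c, triple a b c = 4^-1 *: quasi_Poisson_rhs a b c.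
Proof.
rewrite /quasi_Poisson /triple_bracket /triple /quasi_Poisson_rhs.
by rewrite bracketL.unlock rot123.unlock rot132.unlock otimes.unlock.
Qed.

Lemma quasi_Poisson_rhs_derivation a b : derivation (@out3l k A) (@out3r k A)
    (quasi_Poisson_rhs a b).
Proof.
split=> [c x y|c d].
  rewrite /quasi_Poisson_rhs scaler_sumr -big_split /=; apply: eq_bigr => s _.
  rewrite !mulrDl !mulrDr !alg_scalel !alg_scaler.
  rewrite !(otimesDl, otimesZl, otimesDr, otimesZr).
  by lincomb k (tensor (tensor A A) A).
rewrite /quasi_Poisson_rhs (big_morph _ (linD (out3l_linear c)) (lin0
    (out3l_linear c))).
rewrite (big_morph _ (linD (out3r_linear d)) (lin0 (out3r_linear d))).
rewrite -big_split /=; apply: eq_bigr => s _.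
rewrite !(linD (out3l_linear c)) !(linD (out3r_linear d)).
rewrite !(linN (out3l_linear c)) !(linN (out3r_linear d)).
rewrite !out3l_tens !out3r_tens !outl_tens !mulrA.
by lincomb k (tensor (tensor A A) A).
Qed.

Lemma triple_rot a b c : triple b c a = rot132 (triple a b c).
Proof.
have rotK t : rot132 (rot123 t) = t :> AAA.
  move: t; apply: tensor_ext.
  - exact: linear_comp (@rot132_linear k A) (@rot123_linear k A).
  - exact: linear_id.
  move=> t w; move: t; apply: tensor_ext.
  - apply: linear_comp (@rot132_linear k A) _.
    exact: linear_comp (@rot123_linear k A) (otimes_linl _).
  - exact: otimes_linl.
  by move=> u v; rewrite rot123_tens rot132_tens.
have rotM t : rot132 (rot132 t) = rot123 t :> AAA.
  move: t; apply: tensor_ext.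
  - exact: linear_comp (@rot132_linear k A) (@rot132_linear k A).
  - exact: rot123_linear.
  move=> t w; move: t; apply: tensor_ext.
  - apply: linear_comp (@rot132_linear k A) _.
    exact: linear_comp (@rot132_linear k A) (otimes_linl _).
  - exact: linear_comp (@rot123_linear k A) (otimes_linl _).
  by move=> u v; rewrite rot123_tens !rot132_tens.
rewrite /triple !linearD /= rotK rotM.
by lincomb k (tensor (tensor A A) A).
Qed.

Lemma quasi_Poisson_rhs_rot a b c : quasi_Poisson_rhs b c a = rot132
    (quasi_Poisson_rhs a b c).
Proof.
rewrite /quasi_Poisson_rhs (big_morph _ (linD (@rot132_linear k A)) (lin0
    (@rot132_linear k A))).
apply: eq_bigr => s _.
rewrite !(linD (@rot132_linear k A)) !(linN (@rot132_linear k A)) !rot132_tens.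
by lincomb k (tensor (tensor A A) A).
Qed.

Hypothesis e_orth : orthogonal_idempotents e.

Lemma triple_idem a b s : triple a b (e s) = 0.
Proof.
rewrite /triple (db_idem dbP) (db_idem_l dbP) bracketL_idem.
by rewrite !linear0 !addr0.
Qed.

Lemma quasi_Poisson_rhs_idem a b t : quasi_Poisson_rhs a b (e t) = 0.
Proof.
have [ee _] := e_orth.
rewrite /quasi_Poisson_rhs big1 // => s _; rewrite ee; case: eqP => [->|ne].
  rewrite ee eqxx -!mulrA ee eqxx !mulrA.
  by lincomb k (tensor (tensor A A) A).
rewrite -!mulrA ee; case: eqP => [E|_]; first by case: ne.
by rewrite !(mul0r, mulr0, otimes0l, otimes0r, oppr0, addr0).
Qed.

End TripleBracket.

Section QuasiPoissonOnArrows.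
Variables (k : fieldType) (Q : Type) (src tgt : Q -> 'I_2) (P A : algType k).
Variables (pe : 'I_2 -> P) (py : Q -> P) (pc : 'I_2 -> P).
Variables (iota : P -> A) (inv : 'I_2 -> A).
Hypothesis pr : presentation src tgt pe py pc iota inv.
Local Notation e s := (iota (pe s)).
Local Notation y q := (iota (py q)).
Variable db : A -> A -> tensor A A.
Hypothesis dbP : antisymmetric_biderivation (fun s => e s) db.

(* Both sides of the quasi-Poisson identity are derivations in the last argument
   and are permuted cyclically with their arguments. *)
Lemma quasi_Poisson_arrows :
  (forall p q r, triple db (y p) (y q) (y r)
     = 4^-1 *: quasi_Poisson_rhs (fun s => e s) (y p) (y q) (y r)) ->
  quasi_Poisson (fun s => e s) db.
Proof.
move=> H; apply/quasi_PoissonP.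
have ext a b : (forall q,
    triple db a b (y q) = 4^-1 *: quasi_Poisson_rhs (fun s => e s) a b (y q)) ->
    forall c, triple db a b c = 4^-1 *: quasi_Poisson_rhs (fun s => e s) a b c.
  move=> E; apply: (derivation_ext pr (@bimodule_outer3 k A)) E.
  - exact: (triple_derivation dbP).
  - exact: derivationZ (@bimodule_outer3 k A) _ _ (quasi_Poisson_rhs_derivation _
      _ _).
  move=> s; rewrite (triple_idem dbP) (quasi_Poisson_rhs_idem (pres_Aorth pr)).
  by rewrite scaler0.
have rot a b c : triple db a b c = 4^-1 *: quasi_Poisson_rhs (fun s => e s) a b c
    ->
    triple db b c a = 4^-1 *: quasi_Poisson_rhs (fun s => e s) b c a.
  move=> E; rewrite (triple_rot db a b c) E (linZ (@rot132_linear k A)).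
  by congr (_ *: _); rewrite -quasi_Poisson_rhs_rot.
have H1 (p q : Q) c := ext (y p) (y q) (H p q) c.
have H2 q c a : triple db (y q) c a = 4^-1 *: quasi_Poisson_rhs (fun s => e s) (y
    q) c a.
  apply: ext => r; apply: rot.
  exact: H1.
by move=> a b c; apply: ext => q; apply: rot; exact: H2.
Qed.

End QuasiPoissonOnArrows.

(** * The quasi-Poisson identity on letters *)

Section Letters.
Variables (k : fieldType) (A : algType k) (E : 'I_2 -> A).
Hypothesis E_orth : orthogonal_idempotents E.

Local Notation other := (@rev_ord 2).

Lemma neq_other (s : 'I_2) : s != other s.
Proof. by case: s => -[|[|]]. Qed.

Lemma other_or (s t : 'I_2) : t = s \/ t = other s.
Proof.
by case: s t => -[|[|//]] ? [[|[|//]] ?];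
  (try by left; apply: val_inj); right; apply: val_inj.
Qed.

Lemma sum2 (V : nmodType) (F : 'I_2 -> V) s : \sum_r F r = F s + F (other s).
Proof.
rewrite (bigD1 s) //=; congr (_ + _); rewrite (big_pred1 (other s)) // => r /=.
apply/idP/eqP => [ne|->]; last by rewrite eq_sym neq_other.
by have [E1|//] := other_or s r; rewrite E1 eqxx in ne.
Qed.

(** A set of rewrite rules for products associated to the left. Each rule therefore comes a second
    time behind a prefix [w], and the lemmas on letters and loops follow the same pattern. *)
Lemma idemE s : (E s * E s = E s) * (E (other s) * E (other s) = E (other s)) *
  (E s * E (other s) = 0) * (E (other s) * E s = 0) *
  (forall w, w * E s * E s = w * E s) *
  (forall w, w * E (other s) * E (other s) = w * E (other s)) *
  (forall w, w * E s * E (other s) = 0) * (forall w, w * E (other s) * E s = 0).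
Proof.
have [ee _] := E_orth; have ne := negPf (neq_other s).
by (do !split) => [||||w|w|w|w];
    rewrite -?mulrA ee ?eqxx ?(eq_sym _ s) ?ne ?mulr0.
Qed.

(** Every arrow joins the two distinct vertices, so its source [s] determines its type. *)
Definition letter s (x : A) : Prop := x = E (other s) * x * E s.

Lemma letterE s x : letter s x ->
  (x * E s = x) * (E (other s) * x = x) * (x * E (other s) = 0) * (E s * x = 0) *
  (forall w, w * x * E s = w * x) * (forall w, w * E (other s) * x = w * x) *
  (forall w, w * x * E (other s) = 0) * (forall w, w * E s * x = 0).
Proof.
move=> xE; have R := idemE s.
have xe : x * E s = x by rewrite xE !R.
have fx : E (other s) * x = x by rewrite xE !mulrA !R.
have xf : x * E (other s) = 0 by rewrite xE !R.
have ex : E s * x = 0 by rewrite xE !mulrA !R !mul0r.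
by (do !split) => // w; rewrite -mulrA ?xe ?fx ?xf ?ex ?mulr0.
Qed.

Lemma letter2E s x y : letter s x -> letter s y ->
  (x * y = 0) * (forall w, w * x * y = 0).
Proof.
move=> xE yE; have xy : x * y = 0.
  by rewrite xE yE !mulrA (idemE s) !mul0r.
by split=> // w; rewrite -mulrA xy mulr0.
Qed.

End Letters.

(* The rules needed to evaluate brackets of monomials, over abstract modules T2
   and T3: on the concrete tensor products, failed unifications are expensive. *)
Record bracket_calculus (k : fieldType) (A : algType k) (E : 'I_2 -> A)
    (T2 T3 : lmodType k) (ox : A -> A -> T2) (ox3 : T2 -> A -> T3)
    (outl innl : A -> T2 -> T2) (outr innr : T2 -> A -> T2) (flip : T2 -> T2)
    (rot123 rot132 : T3 -> T3) (db : A -> A -> T2) (bracketL : A -> T2 -> T3) :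
        Prop :=
  BracketCalculus {
  bc_oxl : forall v, linear (fun u => ox u v);
  bc_oxr : forall u, linear (ox u);
  bc_ox3l : forall v, linear (fun u => ox3 u v);
  bc_ox3r : forall u, linear (ox3 u);
  bc_outl : forall a, linear (outl a);
  bc_outr : forall a, linear (outr^~ a);
  bc_innl : forall a, linear (innl a);
  bc_innr : forall a, linear (innr^~ a);
  bc_flip : linear flip;
  bc_rot123 : linear rot123;
  bc_rot132 : linear rot132;
  bc_bracketL : forall a, linear (bracketL a);
  bc_outl_ox : forall x u v, outl x (ox u v) = ox (x * u) v;
  bc_outr_ox : forall x u v, outr (ox u v) x = ox u (v * x);
  bc_innl_ox : forall x u v, innl x (ox u v) = ox u (x * v);
  bc_innr_ox : forall x u v, innr (ox u v) x = ox (u * x) v;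
  bc_flip_ox : forall u v, flip (ox u v) = ox v u;
  bc_rot123_ox : forall u v w, rot123 (ox3 (ox u v) w) = ox3 (ox w u) v;
  bc_rot132_ox : forall u v w, rot132 (ox3 (ox u v) w) = ox3 (ox v w) u;
  bc_bracketL_ox : forall a u v, bracketL a (ox u v) = ox3 (db a u) v;
  bc_dbC : forall a b, db a b = - flip (db b a);
  bc_dbl : forall b, linear (db^~ b);
  bc_dbr : forall a, linear (db a);
  bc_dbM : forall a b c, db a (b * c) = outl b (db a c) + outr (db a b) c;
  bc_dbMl : forall a b c, db (a * b) c = innl a (db b c) + innr (db a c) b;
  bc_idem : forall a s, db a (E s) = 0;
  bc_idem_l : forall a s, db (E s) a = 0 }.

Lemma tensor_calculus (k : fieldType) (A : algType k) (E : 'I_2 -> A)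
    (db : A -> A -> tensor A A) : antisymmetric_biderivation E db ->
  bracket_calculus E (@otimes k A A) (@otimes k (tensor A A) A) (@outl k A)
    (@innl k A) (@outr k A) (@innr k A) (@flip k A) (@rot123 k A) (@rot132 k A)
    db (@bracketL k A db).
Proof.
move=> dbP; split.
- exact: otimes_linl.
- exact: otimes_linr.
- exact: otimes_linl.
- exact: otimes_linr.
- exact: outl_linear.
- exact: outr_linear.
- exact: innl_linear.
- exact: innr_linear.
- exact: flip_linear.
- exact: rot123_linear.
- exact: rot132_linear.
- exact: (bracketL_linear dbP).
- exact: outl_tens.
- move=> x u v; exact: outr_tens.
- exact: innl_tens.
- move=> x u v; exact: innr_tens.
- exact: flip_tens.
- exact: rot123_tens.
- exact: rot132_tens.
- exact: (bracketL_tens dbP).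
- exact: (dbC dbP).
- exact: (db_linl dbP).
- exact: (db_lin dbP).
- exact: (dbM dbP).
- exact: (dbMl dbP).
- exact: (db_idem dbP).
- move=> a s; exact: (db_idem_l dbP).
Qed.

Section Calculus.
Variables (k : fieldType) (A : algType k) (E : 'I_2 -> A).
Variables (T2 T3 : lmodType k) (ox : A -> A -> T2) (ox3 : T2 -> A -> T3).
Variables (outl innl : A -> T2 -> T2) (outr innr : T2 -> A -> T2)
    (flip : T2 -> T2).
Variables (rot123 rot132 : T3 -> T3) (db : A -> A -> T2)
    (bracketL : A -> T2 -> T3).
Hypothesis bc : bracket_calculus E ox ox3 outl innl outr innr flip rot123 rot132
  db bracketL.

Definition oxlE v := lin_rules (bc_oxl bc v).
Definition oxrE v := lin_rules (bc_oxr bc v).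
Definition ox3lE v := lin_rules (bc_ox3l bc v).
Definition ox3rE v := lin_rules (bc_ox3r bc v).
Definition outlE v := (lin_rules (bc_outl bc v), bc_outl_ox bc v).
Definition outrE v := (lin_rules (bc_outr bc v), bc_outr_ox bc v).
Definition innlE v := (lin_rules (bc_innl bc v), bc_innl_ox bc v).
Definition innrE v := (lin_rules (bc_innr bc v), bc_innr_ox bc v).
Definition flipE := (lin_rules (bc_flip bc), bc_flip_ox bc).
Definition rot123E := (lin_rules (bc_rot123 bc), bc_rot123_ox bc).
Definition rot132E := (lin_rules (bc_rot132 bc), bc_rot132_ox bc).
Definition bracketLE v := (lin_rules (bc_bracketL bc v), bc_bracketL_ox bc v).

Hypothesis E_orth : orthogonal_idempotents E.
Local Notation "x \o2 y" := (ox x y) (at level 38, left associativity).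
Local Notation "x \o3 y" := (ox3 x y) (at level 38, left associativity).

Let h : k := 2^-1.

Local Notation other := (@rev_ord 2).

(* The bracket of two arrows x < y with sources s and t; d is the coefficient of
   the constant term, which only occurs when s != t. *)
Definition letter_bracket (s t : 'I_2) (x y : A) (d : k) : T2 :=
  if s == t then - (h *: (x \o2 y)) - h *: (y \o2 x)
  else h *: (E s \o2 (x * y)) + h *: ((y * x) \o2 E t) + d *: (E s \o2 E t).

Lemma bracket_flip x y v : db x y = v -> db y x = - flip v.
Proof. by move=> <-; rewrite (bc_dbC bc). Qed.

Definition quasi_Poisson_rhs_term (g a b c : A) : T3 :=
  (c * g * a) \o2 (g * b) \o3 g - (c * g * a) \o2 g \o3 (b * g)
  - (c * g) \o2 (a * g * b) \o3 g + (c * g) \o2 (a * g) \o3 (b * g)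
  - (g * a) \o2 (g * b) \o3 (g * c) + (g * a) \o2 g \o3 (b * g * c)
  + g \o2 (a * g * b) \o3 (g * c) - g \o2 (a * g) \o3 (b * g * c).

Definition jacobiator (a b c : A) : T3 :=
  bracketL a (db b c) + rot123 (bracketL b (db c a)) + rot132
    (bracketL c (db a b)).

(** The factor 1/4 is written as [h * h], the coefficient that two quadratic terms produce together.
    After expansion both sides are polynomial in [h] and in the constants. *)
Definition jacobi (a b c : A) : Prop :=
  jacobiator a b c = (h * h) *: \sum_r quasi_Poisson_rhs_term (E r) a b c.

Ltac expand_jacobi R :=
  rewrite /jacobiator /quasi_Poisson_rhs_term !R ?bracketLE ?(bc_dbM bc)
    ?(bc_idem bc) ?R ?(outlE, outrE) ?(ox3lE, oxlE, oxrE, ox3rE) ?rot123E ?rot132E ?mulrA.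

Lemma jacobi_lt s t u x y z d d' :
  letter E s x -> letter E t y -> letter E u z ->
  db x y = letter_bracket s t x y d -> db y z = letter_bracket t u y z d' ->
  db x z = letter_bracket s u x z 0 ->
  jacobi x y z /\ jacobi x z y.
Proof.
move=> Lx Ly Lz; rewrite /letter_bracket => xy yz xz.
have sn := negPf (neq_other s).
have ns : (other s == s) = false by rewrite eq_sym.
have Rx := letterE E_orth Lx; have Rs := idemE E_orth s.
rewrite /jacobi !(sum2 _ s).
(* The sum over the vertices is already expanded at the source of [x]. The four cases say which of
   [y] and [z] share this source; in each of them [Rw] records that letters with a common source
   multiply to 0. *)
have [tE|tE] := other_or s t; have [uE|uE] := other_or s u;
  rewrite {}tE ?{}uE ?eqxx ?sn ?ns ?eqxx in Ly Lz xy yz xz;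
  have Ry := letterE E_orth Ly; have Rz := letterE E_orth Lz;
  rewrite ?rev_ordK in Ry Rz;
  have yx := bracket_flip xy; have zy := bracket_flip yz;
  have zx := bracket_flip xz; rewrite !flipE in yx zy zx.
- have Rw := (letter2E E_orth Lx Ly, letter2E E_orth Lx Lz, letter2E E_orth Ly Lz,
    letter2E E_orth Ly Lx, letter2E E_orth Lz Lx, letter2E E_orth Lz Ly).
  split; expand_jacobi (xy, yx, yz, zy, xz, zx);
    rewrite ?(Rx, Ry, Rz, Rs, Rw) ?(mul0r, mulr0, oxlE, oxrE, ox3lE, ox3rE);
    lincomb k T3.
- have Rw := (letter2E E_orth Lx Ly, letter2E E_orth Ly Lx).
  split; expand_jacobi (xy, yx, yz, zy, xz, zx);
    rewrite ?(Rx, Ry, Rz, Rs, Rw) ?(mul0r, mulr0, oxlE, oxrE, ox3lE, ox3rE);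
    lincomb k T3.
- have Rw := (letter2E E_orth Lx Lz, letter2E E_orth Lz Lx).
  split; expand_jacobi (xy, yx, yz, zy, xz, zx);
    rewrite ?(Rx, Ry, Rz, Rs, Rw) ?(mul0r, mulr0, oxlE, oxrE, ox3lE, ox3rE);
    lincomb k T3.
- have Rw := (letter2E E_orth Ly Lz, letter2E E_orth Lz Ly).
  split; expand_jacobi (xy, yx, yz, zy, xz, zx);
    rewrite ?(Rx, Ry, Rz, Rs, Rw) ?(mul0r, mulr0, oxlE, oxrE, ox3lE, ox3rE);
    lincomb k T3.
Qed.

Lemma jacobi_diag s x : letter E s x -> db x x = 0 -> jacobi x x x.
Proof.
move=> Lx xx.
have Rx := letterE E_orth Lx; have Rs := (idemE E_orth s, letter2E E_orth Lx Lx).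
rewrite /jacobi !(sum2 _ s); expand_jacobi xx.
rewrite ?(Rx, Rs) ?(mul0r, mulr0, oxlE, oxrE, ox3lE, ox3rE).
by rewrite ?(lin0 (bc_bracketL bc _), lin0 (bc_rot123 bc), lin0 (bc_rot132 bc));
    lincomb k T3.
Qed.

(** Up to rotation, [x x y] and [x y y] are the only triples formed by exactly two letters. *)
Lemma jacobi_le s t x y d :
  letter E s x -> letter E t y -> db x x = 0 -> db y y = 0 ->
  db x y = letter_bracket s t x y d -> jacobi x x y /\ jacobi x y y.
Proof.
move=> Lx Ly xx yy; rewrite /letter_bracket => xy.
have sn := negPf (neq_other s).
have Rx := letterE E_orth Lx;
    have Rs := (idemE E_orth s, letter2E E_orth Lx Lx, letter2E E_orth Ly Ly).
rewrite /jacobi !(sum2 _ s).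
have [tE|tE] := other_or s t;
  rewrite {}tE ?eqxx ?sn in Ly xy Rs *;
  have Ry := letterE E_orth Ly; rewrite ?rev_ordK in Ry;
  have yx := bracket_flip xy; rewrite !flipE in yx.
- have Rw := (letter2E E_orth Lx Ly, letter2E E_orth Ly Lx).
  split; expand_jacobi (xy, yx, xx, yy);
    rewrite ?(Rx, Ry, Rs, Rw) ?(mul0r, mulr0, outlE, outrE, oxlE, oxrE, ox3lE,
        ox3rE) ?(rot123E, rot132E);
    lincomb k T3.
- split; expand_jacobi (xy, yx, xx, yy);
    rewrite ?(Rx, Ry, Rs) ?(mul0r, mulr0, outlE, outrE, oxlE, oxrE, ox3lE,
        ox3rE) ?(rot123E, rot132E);
    lincomb k T3.
Qed.

End Calculus.

(** * Brackets of continuants *)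

Section ContinuantBrackets.
Variables (k : fieldType) (A : algType k) (E : 'I_2 -> A).
Variables (T2 T3 : lmodType k) (ox : A -> A -> T2) (ox3 : T2 -> A -> T3).
Variables (outl innl : A -> T2 -> T2) (outr innr : T2 -> A -> T2)
    (flip : T2 -> T2).
Variables (rot123 rot132 : T3 -> T3) (db : A -> A -> T2)
    (bracketL : A -> T2 -> T3).
Hypothesis bc : bracket_calculus E ox ox3 outl innl outr innr flip rot123 rot132
  db bracketL.
Hypothesis E_orth : orthogonal_idempotents E.
Local Notation "x \o2 y" := (ox x y) (at level 38, left associativity).
Local Notation other := (@rev_ord 2).
Variables (eps : k) (s : 'I_2) (z : nat -> A) (m : nat).
Let h : k := 2^-1.
Hypothesis h2 : h + h = 1.
Local Notation e := (E s).
Local Notation f := (E (other s)).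

(* The vertex at which the j-th letter starts. *)
Definition alt (j : nat) : 'I_2 := if odd j then other s else s.

Hypothesis z_letter : forall j, (j < m)%N -> letter E (alt j) (z j).
Hypothesis z_diag : forall j, (j < m)%N -> db (z j) (z j) = 0.
(** The factor [eps] is 1 for the word and -1 for its reversal, which allows both continuants to be
    treated at once. *)
Hypothesis z_bracket : forall i j, (i < j < m)%N ->
  db (z i) (z j)
    = eps *: letter_bracket E ox (alt i) (alt j) (z i) (z j) (j == i.+1)%:R.

(* The continuant of the first j letters together with that of the first j - 1;
   the latter is 0 by convention for j = 0. *)
Fixpoint rec_continuant (j : nat) : A * A :=
  if j is j'.+1 then ((rec_continuant j').1 * z j' + (rec_continuant j').2,
      (rec_continuant j').1) else (f, 0).

(** The closed form of [{{c, z}}] up to [eps], for the continuant [c] of the first [i] letters and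
    the letter [z] of index [j], counted from 0. Here [inside] stands for [j < i], [kodd] and [jodd]
    are the parities of [i] and [j], [cp] is the preceding continuant, and [d] is 1 exactly if
    [j = i], that is, if [z] is the letter following the prefix. For odd [i] and a letter outside,
    it is the bracket of two letters with [cp] in the place of the second idempotent of the constant
    term. *)
Definition inner_outer_form (inside kodd jodd : bool) (c z cp : A) (d : k) : T2 :=
  if inside then
    if kodd then
      if jodd then h *: ((z * c) \o2 f) - h *: (e \o2 (c * z))
      else h *: (z \o2 c) - h *: (c \o2 z)
    else
      if jodd then h *: (z \o2 c) + h *: ((z * c) \o2 f)
      else - (h *: (f \o2 (c * z))) - h *: (c \o2 z)
  else
    if kodd then
      if jodd then h *: (e \o2 (c * z)) + h *: ((z * c) \o2 f) + d *: (e \o2 cp)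
      else - (h *: (c \o2 z)) - h *: (z \o2 c)
    else
      if jodd then h *: ((z * c) \o2 f) - h *: (z \o2 c)
      else h *: (f \o2 (c * z)) - h *: (c \o2 z) + d *: (f \o2 cp).

Definition loop (v : 'I_2) (x : A) : Prop := x = E v * x * E v.

Lemma loopE v x : loop v x ->
  (x * E v = x) * (E v * x = x) * (x * E (other v) = 0) * (E (other v) * x = 0) *
  (forall w, w * x * E v = w * x) * (forall w, w * E v * x = w * x) *
  (forall w, w * x * E (other v) = 0) * (forall w, w * E (other v) * x = 0).
Proof.
move=> xE; have R := idemE E_orth v.
have xe : x * E v = x by rewrite xE !R.
have ex : E v * x = x by rewrite xE !mulrA !R.
have xf : x * E (other v) = 0 by rewrite xE !R.
have fx : E (other v) * x = 0 by rewrite xE !mulrA !R !mul0r.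
by (do !split) => // w; rewrite -mulrA ?xe ?fx ?xf ?ex ?mulr0.
Qed.

Definition ctype (kodd : bool) (c : A) : Prop :=
  if kodd then letter E s c else loop (other s) c.

Lemma continuant_type j : (j <= m)%N ->
  ctype (odd j) (rec_continuant j).1 /\ ctype (~~ odd j) (rec_continuant j).2.
Proof.
have R := idemE E_orth s.
elim: j => [_|j IH jm] /=.
  by split; rewrite /ctype /= /loop /letter ?R // mulr0 mul0r.
have [] := IH (ltnW jm); have := z_letter jm; rewrite /alt.
case: (odd j) => /= zt c1 c2; split=> //.
- have Rc := letterE E_orth c1; have Rd := loopE c2; have Rz := letterE E_orth zt.
  rewrite ?rev_ordK in Rd Rz.
  by rewrite /loop mulrDr mulrDl !mulrA !(Rc, Rd, Rz).
- have Rc := loopE c1; have Rd := letterE E_orth c2; rewrite ?rev_ordK in Rc.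
  have Rz := letterE E_orth zt.
  by rewrite /letter mulrDr mulrDl !mulrA !(Rc, Rd, Rz).
Qed.

(** Types are given by the parity instead of the index, so that a case analysis on Booleans decides
    all products of [c], [w], [x] and the idempotents. *)
Definition alt_letter (odd : bool) (x : A) : Prop :=
  letter E (if odd then other s else s) x.
Definition alt_bracket (i j : bool) (x y : A) (d : k) : T2 :=
  eps *: letter_bracket E ox (if i then other s else s) (if j then other s else s)
    x y d.

Lemma typeE (kodd : bool) c : ctype kodd c -> let v := if kodd then s else other
    s in
  (c * E s = if kodd then c else 0) * (E (other s) * c = c) *
  (c * E (other s) = if kodd then 0 else c) * (E s * c = 0) *
  (forall w, w * c * E s = if kodd then w * c else 0) *
  (forall w, w * E (other s) * c = w * c) *
  (forall w, w * c * E (other s) = if kodd then 0 else w * c) *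
  (forall w, w * E s * c = 0).
Proof.
case: kodd => /= [/(letterE E_orth)|/loopE] R; rewrite ?rev_ordK in R.
  by (do !split) => *; rewrite ?R.
by (do !split) => *; rewrite ?R.
Qed.

Lemma alt_letterE (j : bool) x : alt_letter j x ->
  (x * E s = if j then 0 else x) * (E (other s) * x = if j then 0 else x) *
  (x * E (other s) = if j then x else 0) * (E s * x = if j then x else 0) *
  (forall w, w * x * E s = if j then 0 else w * x) *
  (forall w, w * E (other s) * x = if j then 0 else w * x) *
  (forall w, w * x * E (other s) = if j then w * x else 0) *
  (forall w, w * E s * x = if j then w * x else 0).
Proof.
rewrite /alt_letter; case: j => /= /(letterE E_orth) R; rewrite ?rev_ordK in R;
  by (do !split) => *; rewrite ?R.
Qed.

Lemma alt_letter2E (j : bool) x y : alt_letter j x -> alt_letter j y ->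
  (x * y = 0) * (forall w, w * x * y = 0).
Proof. by rewrite /alt_letter => Lx Ly; exact: (letter2E E_orth Lx Ly). Qed.

Ltac step_ring T0 T1 Tw Tx :=
  let R := fresh "R" in let R0 := fresh "R0" in let R1 := fresh "R1" in
  let Rw := fresh "Rw" in let Rx := fresh "Rx" in
  let sn := fresh "sn" in let ns := fresh "ns" in
  have R := idemE E_orth s; have R0 := typeE T0; have R1 := typeE T1;
  have Rw := alt_letterE Tw; have Rx := alt_letterE Tx;
  have sn := negPf (neq_other s);
  have ns : (other s == s) = false by [rewrite eq_sym];
  rewrite /alt_bracket /inner_outer_form /letter_bracket -/h /= in R0 R1 Rw Rx *;
  rewrite ?eqxx ?sn ?ns ?(flipE bc, innlE bc, innrE bc) ?(mulrDl, mulrDr) ?mulrA;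
  rewrite ?(oxlE bc, oxrE bc) ?(R0, R1, Rw, Rx, R) ?(mul0r, mulr0)
    ?(oxlE bc, oxrE bc, mul0r, mulr0);
  lincomb k T2.

(** Four lemmas compute the bracket of [c1 * w + c0] with a letter [x] of index [j], where [c0] has
    [i] letters and [w] has index [i + 1]: the cases are [j < i], [j = i], [j = i + 1] and
    [j > i + 1]. In this first one [x] lies in both shorter prefixes and is no neighbour of [w], so
    that no constant occurs. *)
Lemma bracket_step_inside (kodd jodd : bool) (c0 c1 cp cp' w x : A) d' :
  ctype kodd c0 -> ctype (~~ kodd) c1 -> alt_letter (~~ kodd) w ->
  alt_letter jodd x ->
  db c0 x = eps *: inner_outer_form true kodd jodd c0 x cp 0 ->
  db c1 x = eps *: inner_outer_form true (~~ kodd) jodd c1 x c0 0 ->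
  db x w = alt_bracket jodd (~~ kodd) x w 0 ->
  db (c1 * w + c0) x = eps *: inner_outer_form true kodd jodd (c1 * w + c0) x cp'
      d'.
Proof.
move=> T0 T1 Tw Tx H0 H1 Hw.
rewrite (linD (bc_dbl bc x)) (bc_dbMl bc) (bc_dbC bc w) Hw H0 H1 {H0 H1 Hw}.
case: kodd jodd T0 T1 Tw Tx => -[] T0 T1 Tw Tx; step_ring T0 T1 Tw Tx.
Qed.

(* Here x is the letter preceding w, so that c1 = c0 x + cp. *)
Lemma bracket_step_prev (kodd : bool) (c0 cp cp' w x : A) d' :
  let c1 := c0 * x + cp in
  ctype kodd c0 -> ctype (~~ kodd) c1 -> ctype (~~ kodd) cp ->
  alt_letter (~~ kodd) w -> alt_letter kodd x ->
  db c0 x = eps *: inner_outer_form false kodd kodd c0 x cp 1 ->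
  db c1 x = eps *: inner_outer_form true (~~ kodd) kodd c1 x c0 0 ->
  db x w = alt_bracket kodd (~~ kodd) x w 1 ->
  db (c1 * w + c0) x = eps *: inner_outer_form true kodd kodd (c1 * w + c0) x cp'
      d'.
Proof.
(* The constant 1 of [Hw], multiplied by [c1 = c0 * x + cp], gives a full copy of a term in [c0 * x]
   and of one in [cp]. The latter cancels the constant of [H0]. The former meets a half of opposite
   sign from [H0], and writing 1 as [h + h] leaves the half that the closed form contains. *)
move=> c1 T0 T1 Tp Tw Tx H0 H1 Hw; rewrite -h2 in H0 Hw.
rewrite (linD (bc_dbl bc x)) (bc_dbMl bc) (bc_dbC bc w) Hw H0 H1 {H0 H1 Hw}.
have Rp := typeE Tp; rewrite {}/c1 in T1 *.
case: kodd T0 T1 Tw Tx Tp Rp => T0 T1 Tw Tx Tp /= Rp.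
  have R2 := alt_letter2E Tx Tx; step_ring T0 Tp Tw Tx.
have R2 := alt_letter2E Tx Tx; step_ring T0 Tp Tw Tx.
Qed.

Lemma bracket_step_last (kodd : bool) (c0 c1 cp cp' w : A) d' :
  ctype kodd c0 -> ctype (~~ kodd) c1 -> alt_letter (~~ kodd) w ->
  db c0 w = eps *: inner_outer_form false kodd (~~ kodd) c0 w cp 0 ->
  db c1 w = eps *: inner_outer_form false (~~ kodd) (~~ kodd) c1 w c0 1 ->
  db w w = 0 ->
  db (c1 * w + c0) w = eps *: inner_outer_form true kodd (~~ kodd) (c1 * w + c0)
      w cp' d'.
Proof.
(* The letter [w] follows the prefix of [c1], so [H1] has the constant 1. After multiplication by
   [w] it becomes a full [w \ox c0], of which [H0] takes away a half. *)
move=> T0 T1 Tw H0 H1 Hw; rewrite -h2 in H1.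
rewrite (linD (bc_dbl bc w)) (bc_dbMl bc) Hw H0 H1 {H0 H1 Hw}.
case: kodd T0 T1 Tw => T0 T1 Tw; have R2 := alt_letter2E Tw Tw;
  step_ring T0 T1 Tw Tw.
Qed.

(** The new constant term arises from that of [{{w, x}}], multiplied by [c1]. This is why the
    preceding continuant appears in the closed form. *)
Lemma bracket_step_outside (kodd jodd : bool) (c0 c1 cp w x : A) d :
  ctype kodd c0 -> ctype (~~ kodd) c1 -> alt_letter (~~ kodd) w ->
  alt_letter jodd x ->
  db c0 x = eps *: inner_outer_form false kodd jodd c0 x cp 0 ->
  db c1 x = eps *: inner_outer_form false (~~ kodd) jodd c1 x c0 0 ->
  db w x = alt_bracket (~~ kodd) jodd w x d ->
  db (c1 * w + c0) x = eps *: inner_outer_form false kodd jodd (c1 * w + c0) x c1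
      d.
Proof.
move=> T0 T1 Tw Tx H0 H1 Hw.
rewrite (linD (bc_dbl bc x)) (bc_dbMl bc) Hw H0 H1 {H0 H1 Hw}.
case: kodd jodd T0 T1 Tw Tx => -[] T0 T1 Tw Tx; step_ring T0 T1 Tw Tx.
Qed.

Definition continuant_bracket_at (i : nat) : Prop := forall j, (j < m)%N ->
  db (rec_continuant i).1 (z j)
    = eps *: inner_outer_form (j < i)%N (odd i) (odd j) (rec_continuant i).1 (z
        j) (rec_continuant i).2 (j == i)%:R.

Lemma z_alt j : (j < m)%N -> alt_letter (odd j) (z j).
Proof. exact: z_letter. Qed.

Lemma z_alt_bracket i j : (i < j < m)%N ->
  db (z i) (z j) = alt_bracket (odd i) (odd j) (z i) (z j) (j == i.+1)%:R.
Proof. exact: z_bracket. Qed.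

(** The empty continuant is an idempotent, so its bracket vanishes. The closed form agrees with
    this: its two halves cancel by the type of the letter, and its constant is multiplied by the
    conventional value 0 of the preceding continuant. *)
Lemma continuant_bracket0 : continuant_bracket_at 0.
Proof.
move=> j jm; rewrite (bc_idem_l bc) /inner_outer_form /= (lin0 (bc_oxr bc _)).
have Rz := alt_letterE (z_alt jm); case: (odd j) Rz => /= Rz; rewrite !Rz.
  by rewrite subrr scaler0.
by rewrite subrr add0r !scaler0.
Qed.

Lemma continuant_bracket1 : (0 < m)%N -> continuant_bracket_at 1.
Proof.
move=> m0 j jm; rewrite /= addr0.
have -> : f * z 0 = z 0 by rewrite (alt_letterE (z_alt m0)).
case: j jm => [|j] jm.
  by rewrite z_diag // /inner_outer_form /= subrr scaler0.
rewrite z_alt_bracket // /alt_bracket /letter_bracket -/h /inner_outer_form /=.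
have sn := negPf (neq_other s).
by case: (odd j) => /=; rewrite ?eqxx ?sn.
Qed.

Lemma continuant_bracketSS i : (i.+2 <= m)%N ->
  continuant_bracket_at i -> continuant_bracket_at i.+1 -> continuant_bracket_at
      i.+2.
Proof.
move=> im IH0 IH1 j jm.
have [T0 Tp] := continuant_type (ltnW (ltnW im));
    have [T1 _] := continuant_type (ltnW im).
have Tw := z_alt im; have Tx := z_alt jm.
have {}IH0 := IH0 j jm; have {}IH1 := IH1 j jm.
rewrite [odd i.+2]negbK; have [ji|ij|ji] := ltngtP j i.
- have ji2 : (j < i.+2)%N by rewrite ltnW // ltnW.
  rewrite ji2; have ji1 : (j < i.+1)%N by rewrite ltnW.
  rewrite ji in IH0; rewrite ji1 in IH1.
  apply: (bracket_step_inside (cp := (rec_continuant i).2) _ _ T0 T1 Tw Tx IH0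
      IH1).
  rewrite z_alt_bracket ?ji1 //.
  by rewrite eqSS eq_sym (ltn_eqF ji).
- move: ij; rewrite leq_eqVlt => /orP[/eqP jE|ij].
    rewrite -{}jE in IH0 IH1 jm Tx *.
    rewrite ltnn /= ltnNge leqnSn eqxx in IH0 IH1; rewrite ltnSn.
    apply: (bracket_step_last (cp := (rec_continuant i).2) _ _ T0 T1 Tw) => //.
      by rewrite IH0 -[i.+1]addn1 -[X in _ == X]addn0 eqn_add2l.
    exact: z_diag.
  have j2 : (j < i.+2)%N = false by rewrite ltnNge ij.
  have j1 : (j < i.+1)%N = false by rewrite ltnNge ltnW.
  have j0 : (j < i)%N = false by rewrite ltnNge ltnW // ltnW.
  rewrite j2; rewrite j1 (gtn_eqF ij) in IH1;
      rewrite j0 (gtn_eqF (ltnW ij)) in IH0.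
  apply: (bracket_step_outside (cp := (rec_continuant i).2) T0 T1 Tw Tx IH0 IH1).
  by rewrite z_alt_bracket // ij.
rewrite {}ji in IH0 IH1 jm Tx *.
rewrite ltnn eqxx in IH0; rewrite ltnSn in IH1; rewrite leqnSn.
apply: (bracket_step_prev _ _ T0 T1 Tp Tw Tx IH0 IH1).
by rewrite z_alt_bracket ?ltnSn // eqxx.
Qed.

Lemma continuant_bracket i : (i <= m)%N -> continuant_bracket_at i.
Proof.
suff H : (i <= m)%N -> continuant_bracket_at i /\ ((i.+1 <= m)%N ->
    continuant_bracket_at i.+1).
  by move=> /H[].
elim: i => [_|i IH im]; first by split;
    [exact: continuant_bracket0 | exact: continuant_bracket1].
have [H0 H1] := IH (ltnW im); split; first exact: H1.
by move=> im2; apply: continuant_bracketSS => //; exact: H1.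
Qed.

(** All letters now lie inside, and the closed form is the moment map formula at the vertex
    [other s]: according to the type of the letter, two of the four terms of that formula vanish. *)
Lemma continuant_moment : ~~ odd m -> forall j, (j < m)%N ->
  let c := (rec_continuant m).1 in let x := z j in
  db c x = eps *: (h *: ((x * f) \o2 c - f \o2 (c * x) + (x * c) \o2 f - c \o2 (f
      * x))).
Proof.
move=> modd j jm c x; rewrite continuant_bracket // jm (negPf modd) -/c -/x;
    congr (_ *: _).
have [Tc _] := continuant_type (leqnn m); rewrite (negPf modd) -/c in Tc.
have Rc := typeE Tc; have Rx := alt_letterE (z_alt jm); rewrite -/x in Rx.
have cx : if odd j then c * x = 0 else x * c = 0.
  case: (odd j) Rx => /= Rx; rewrite /= in Rc.
    have {1}<- : c * f = c by rewrite Rc.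
    by rewrite Rx.
  have {1}<- : x * e = x by rewrite Rx.
  by rewrite Rc.
rewrite /inner_outer_form; case: (odd j) Rx cx => Rx cx; rewrite /= in Rc Rx;
    rewrite !Rx cx
  !(lin0 (bc_oxl bc _), lin0 (bc_oxr bc _)); lincomb k T2.
Qed.

End ContinuantBrackets.

(** * The Hamiltonian structure *)

Section LetterBrackets.
Variables (k : fieldType) (A : algType k) (E : 'I_2 -> A) (T2 : lmodType k).
Variables (ox : A -> A -> T2) (flip : T2 -> T2).
Variables (outl : A -> T2 -> T2) (outr : T2 -> A -> T2).
Hypothesis E_orth : orthogonal_idempotents E.
Hypothesis flip_lin : linear flip.
Hypothesis flip_ox : forall u v, flip (ox u v) = ox v u.
Hypothesis outl_lin : forall a, linear (outl a).
Hypothesis outr_lin : forall a, linear (outr^~ a).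
Hypothesis outl_ox : forall x u v, outl x (ox u v) = ox (x * u) v.
Hypothesis outr_ox : forall x u v, outr (ox u v) x = ox u (v * x).
Local Notation lb := (letter_bracket E ox).

Lemma flip_letter_bracket s t x z d : flip (lb s t x z d) = lb t s z x d.
Proof.
rewrite /letter_bracket (eq_sym t); case: (s == t).
  by rewrite !(lin_rules flip_lin) !flip_ox addrC.
by rewrite !(lin_rules flip_lin) !flip_ox [X in X + _]addrC.
Qed.

Lemma letter_bracket_typed s t x z d : letter E s x -> letter E t z ->
  outl (E (rev_ord t)) (outr (lb s t x z d) (E t)) = lb s t x z d.
Proof.
move=> Lx Lz.
have Rx := letterE E_orth Lx; have Rz := letterE E_orth Lz.
have R := idemE E_orth s.
rewrite /letter_bracket; have [tE|tE] := other_or s t; rewrite {}tE in Lz Rz *.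
  rewrite eqxx !(lin_rules (outr_lin _)) !outr_ox !(lin_rules (outl_lin _))
      !outl_ox.
  by rewrite !(Rx, Rz).
rewrite (negPf (neq_other _)) ?rev_ordK in Rz *.
rewrite !(lin_rules (outr_lin _)) !outr_ox !(lin_rules (outl_lin _)) !outl_ox.
by rewrite !mulrA !(Rx, Rz, R).
Qed.

End LetterBrackets.

Section HamiltonianStructure.
Variables (k : fieldType) (Q : Type) (src tgt : Q -> 'I_2) (P A : algType k).
Variables (pe : 'I_2 -> P) (py : Q -> P) (pc : 'I_2 -> P).
Variables (iota : P -> A) (inv : 'I_2 -> A).
Hypothesis pr : presentation src tgt pe py pc iota inv.
Local Notation E := (fun s => iota (pe s)).
Local Notation y q := (iota (py q)).
Local Notation other := (@rev_ord 2).
Local Notation AA := (tensor A A).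
Let h : k := 2^-1.
Hypothesis h2 : h + h = 1.

(* The arrows are ordered as the letters of the word a_1 b_1 ... a_n b_n. *)
Variables (N : nat) (pos : Q -> nat) (w : nat -> Q).
Hypothesis N_even : ~~ odd N.
Hypothesis pos_lt : forall q, (pos q < N)%N.
Hypothesis posK : forall q, w (pos q) = q.
Hypothesis wK : forall j, (j < N)%N -> pos (w j) = j.
Hypothesis src_pos : forall q, src q = alt v1 (pos q).
Hypothesis tgt_src : forall q, tgt q = other (src q).
Hypothesis cont2 : iota (pc v2) = (rec_continuant E v1 (fun j => y (w j)) N).1.
Hypothesis cont1 : iota (pc v1) = (rec_continuant E v2 (fun j => y (w (N -
    j.+1))) N).1.

Let E_orth := pres_Aorth pr.

Lemma arrow_letter q : letter E (src q) (y q).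
Proof. by rewrite /letter -tgt_src; exact: (pres_Aarrow pr). Qed.

Local Notation lb p q d := (letter_bracket E (@otimes k A A) (src p) (src q) (y
    p) (y q) d).

Definition arrow_bracket (p q : Q) : AA :=
  if (pos p < pos q)%N then lb p q (pos q == (pos p).+1)%:R
  else if (pos q < pos p)%N then - lb p q (pos p == (pos q).+1)%:R
  else 0.

Lemma arrow_bracketC p q : arrow_bracket p q = - flip (arrow_bracket q p).
Proof.
have flipE := flip_letter_bracket E (@flip_linear k A) (@flip_tens k A).
rewrite /arrow_bracket; case: ltngtP => _.
- by rewrite (linN (@flip_linear k A)) flipE opprK.
- by rewrite flipE.
- by rewrite (lin0 (@flip_linear k A)) oppr0.
Qed.

Lemma arrow_bracket_typed p q :
  arrow_bracket p q = outl (E (tgt q)) (outr (arrow_bracket p q) (E (src q))).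
Proof.
have typed d : outl (E (tgt q)) (outr (lb p q d) (E (src q))) = lb p q d.
  rewrite tgt_src; apply: (letter_bracket_typed E_orth (@outl_linear k A)
    (@outr_linear k A) (@outl_tens k A)) d (arrow_letter p) (arrow_letter q).
  by move=> x u v; exact: outr_tens.
rewrite /arrow_bracket; case: ifP => _; last case: ifP => _.
- by rewrite typed.
- rewrite (bimod_rN (@bimodule_outer k A)) (linN (@outl_linear k A _)).
  by rewrite typed.
- by rewrite (bimod_r0 (@bimodule_outer k A)) (lin0 (@outl_linear k A _)).
Qed.

Variable db : A -> A -> AA.
Hypothesis dbP : antisymmetric_biderivation E db.
Hypothesis dbE : forall p q, db (y p) (y q) = arrow_bracket p q.
Let bc := tensor_calculus dbP.

Lemma db_lt p q : (pos p < pos q)%N ->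
  db (y p) (y q) = lb p q (pos q == (pos p).+1)%:R.
Proof. by rewrite dbE /arrow_bracket => ->. Qed.

Lemma db_diag q : db (y q) (y q) = 0.
Proof. by rewrite dbE /arrow_bracket ltnn. Qed.

Lemma quarter : 4^-1 = h * h.
Proof. by rewrite /h -invfM -natrM. Qed.

Lemma quasi_Poisson_presented : quasi_Poisson E db.
Proof.
pose J p q r := triple db (y p) (y q) (y r) = 4^-1 *: quasi_Poisson_rhs E (y p)
    (y q) (y r).
have JP p q r : jacobi E (@otimes k A A) (@otimes k AA A) (@rot123 k A)
    (@rot132 k A) db (@bracketL k A db) (y p) (y q) (y r) -> J p q r.
  by rewrite /J quarter.
have rot p q r : J p q r -> J q r p.
  rewrite /J => JE; rewrite (triple_rot db (y p)) JE (linZ (@rot132_linear k A)).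
  by congr (_ *: _); rewrite -quasi_Poisson_rhs_rot.
have Jlt p q r : (pos p < pos q < pos r)%N -> J p q r /\ J p r q.
  move=> /andP[pq qr]; have pr' := ltn_trans pq qr.
  have pr0 : db (y p) (y r) = lb p r 0.
    by rewrite (db_lt pr') (gtn_eqF (leq_ltn_trans pq qr)).
  have [] := jacobi_lt bc E_orth (arrow_letter p) (arrow_letter q)
    (arrow_letter r) (db_lt pq) (db_lt qr) pr0.
  by move=> /JP J1 /JP J2.
have Jle p q : (pos p < pos q)%N -> J p p q /\ J p q q.
  move=> pq; have [] := jacobi_le bc E_orth (arrow_letter p) (arrow_letter q)
    (db_diag p) (db_diag q) (db_lt pq).
  by move=> /JP J1 /JP J2.
have Jpp p : J p p p.
  exact/JP/(jacobi_diag bc E_orth (arrow_letter p) (db_diag p)).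
have posI p q : pos p = pos q -> p = q by move=> pq; rewrite -[p]posK pq posK.
(* Rotation makes it possible to assume that the first arrow is minimal. What remains is the order
   of the other two and the possible coincidences. *)
have Jmin p q r : (pos p <= pos q)%N -> (pos p <= pos r)%N -> J p q r.
  rewrite leq_eqVlt => /orP[/eqP/posI<-|pq].
    rewrite leq_eqVlt => /orP[/eqP/posI<-|pr']; first exact: Jpp.
    by case: (Jle _ _ pr').
  rewrite leq_eqVlt => /orP[/eqP/posI<-|pr'].
    by apply: rot; case: (Jle _ _ pq).
  case: (ltngtP (pos q) (pos r)) => [qr|rq|/posI<-].
  - by case: (Jlt p q r) => //; rewrite pq.
  - by case: (Jlt p r q) => //; rewrite pr'.
  - by case: (Jle _ _ pq).
apply: (quasi_Poisson_arrows pr dbP) => p q r; rewrite -/(J p q r).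
case: (leqP (pos p) (pos q)) => pq; case: (leqP (pos p) (pos r)) => pr'.
- exact: Jmin.
- by apply: rot; apply: Jmin; [exact: ltnW | exact: leq_trans (ltnW pr') pq].
- by apply/rot/rot; apply: Jmin; [| exact: ltnW]; exact: leq_trans (ltnW pq) pr'.
case: (leqP (pos q) (pos r)) => qr.
  by apply/rot/rot; apply: Jmin; [| exact: ltnW].
by apply: rot; apply: Jmin; exact: ltnW.
Qed.


Definition moment_form (v : 'I_2) (Phi a : A) : AA :=
  h *: ((a * E v) \ox Phi - E v \ox (Phi * a) + (a * Phi) \ox E v
        - Phi \ox (E v * a)).

Definition moment_at (sgn : k) (v : 'I_2) (Phi : A) : Prop :=
  forall a, db Phi a = sgn *: moment_form v Phi a.

Let biO := @bimodule_outer k A.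
Let biI := @bimodule_inner k A.

Lemma moment_form_derivation v Phi :
  derivation (@outl k A) (@outr k A) (moment_form v Phi).
Proof.
split=> [c a b|a b]; rewrite /moment_form.
  rewrite !mulrDl !mulrDr !alg_scalel !alg_scaler.
  rewrite !otimesDl !otimesDr !otimesZl !otimesZr.
  by lincomb k (tensor A A).
rewrite (linZ (@outl_linear k A a)) (linZ (outr_linear b)) -scalerDr.
congr (_ *: _).
rewrite !(linD (@outl_linear k A a)) !(linN (@outl_linear k A a)).
rewrite !(linD (outr_linear b)) !(linN (outr_linear b)).
rewrite !outl_tens !outr_tens !mulrA.
by lincomb k (tensor A A).
Qed.

Lemma moment_form_idem v Phi s : loop E v Phi -> moment_form v Phi (E s) = 0.
Proof.
move=> L; have R := idemE E_orth v; have RL := loopE E_orth L.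
have [->|->] := other_or v s; rewrite /moment_form !(R, RL).
  by rewrite subrr add0r subrr scaler0.
by rewrite !(otimes0l, otimes0r) subrr add0r subrr scaler0.
Qed.

Lemma moment_of_arrows sgn v Phi : loop E v Phi ->
  (forall q, db Phi (y q) = sgn *: moment_form v Phi (y q)) ->
  moment_at sgn v Phi.
Proof.
move=> L H; apply: (derivation_ext pr biO (D := db Phi)
    (D' := fun a => sgn *: moment_form v Phi a)) => //.
- exact: (db_outer dbP).
- exact: derivationZ biO _ _ (moment_form_derivation v Phi).
- by move=> s; rewrite (db_idem dbP) moment_form_idem // scaler0.
Qed.

(** The bracket [{{J, a}}] is [- J {{X, a}} J] for the inner structure. Multiplying by [J] on both
    sides carries the four terms of [moment_form v X a] to those of [moment_form v J a], so
    inversion only changes the sign. *)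
Lemma moment_inv v X J : loop E v J -> X * J = E v -> J * X = E v ->
  moment_at (-1) v X -> moment_at 1 v J.
Proof.
move=> L XJ JX H a; have RL := loopE E_orth L.
have E0 : innl J (db (X * J) a) = 0.
  by rewrite XJ (db_idem_l dbP) (lin0 (@innl_linear k A J)).
have EJ : innl (E v) (db J a) = db J a.
  have := dbMl dbP (E v) J a; rewrite RL (db_idem_l dbP).
  by rewrite (bimod_r0 biI) addr0 => <-.
move: E0; rewrite (dbMl dbP) (linD (@innl_linear k A J)) -(bimod_lM biI) JX EJ.
rewrite H scaleN1r (bimod_rN biI) (linN (@innl_linear k A J)) => /eqP.
rewrite subr_eq0 => /eqP ->; rewrite scale1r /moment_form.
rewrite (bimod_rZ biI) (bimod_lZ biI); congr (_ *: _).
rewrite !(linD (innr_linear J)) !(linN (innr_linear J)) !innr_tens.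
rewrite !(linD (@innl_linear k A J)) !(linN (@innl_linear k A J)) !innl_tens.
rewrite !mulrA JX !RL -(mulrA _ X J) XJ.
by lincomb k (tensor A A).
Qed.

Lemma moment_continuant2 : loop E v2 (iota (pc v2)) /\ moment_at 1 v2 (iota (pc
    v2)).
Proof.
have zl j : (j < N)%N -> letter E (alt v1 j) (y (w j)).
  by move=> jN; rewrite -[in alt _ _](wK jN) -src_pos; exact: arrow_letter.
have ov : rev_ord v1 = v2 by apply: val_inj.
have L : loop E v2 (iota (pc v2)).
  have [] := continuant_type E_orth zl (leqnn N).
  by rewrite -cont2 (negPf N_even) /= ov.
split=> //; apply: moment_of_arrows => // q.
have zd j : (j < N)%N -> db (y (w j)) (y (w j)) = 0 by move=> _; exact: db_diag.
have zb i j : (i < j < N)%N -> db (y (w i)) (y (w j)) = 1 *: letter_bracket E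
    (@otimes k A A) (alt v1 i) (alt v1 j) (y (w i)) (y (w j)) (j == i.+1)%:R.
  move=> /andP[ij jN]; have iN := ltn_trans ij jN.
  have lt : (pos (w i) < pos (w j))%N by rewrite !wK.
  by rewrite scale1r (db_lt lt) !src_pos !wK.
have := continuant_moment bc E_orth h2 zl zd zb N_even (pos_lt q).
by rewrite posK -cont2 ov => ->.
Qed.

Lemma moment_continuant1_inv : moment_at 1 v1 (inv v1).
Proof.
have rN j : (j < N)%N -> (N - j.+1 < N)%N by move=> jN;
    rewrite ltn_subrL (leq_trans _ jN).
(* As [N] is even, reversal exchanges the parities of the positions, and the reversed word starts at
   [v2]. *)
have srcE j : (j < N)%N -> src (w (N - j.+1)) = alt v2 j.
  move=> jN; rewrite src_pos (wK (rN j jN)) /alt oddB // (negPf N_even) /= .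
  by case: (odd j); apply: val_inj.
have zl j : (j < N)%N -> letter E (alt v2 j) (y (w (N - j.+1))).
  by move=> jN; rewrite -(srcE j jN); exact: arrow_letter.
have ov : rev_ord v2 = v1 by apply: val_inj.
have L : loop E v1 (iota (pc v1)).
  have [] := continuant_type E_orth zl (leqnn N).
  by rewrite -cont1 (negPf N_even) /= ov.
apply: (moment_inv (X := iota (pc v1))).
- exact: (pres_inv pr).
- exact: (pres_invr pr).
- exact: (pres_invl pr).
apply: moment_of_arrows => // q.
have zd j : (j < N)%N -> db (y (w (N - j.+1))) (y (w (N - j.+1))) = 0.
  by move=> _; exact: db_diag.
(* Reversal interchanges the two letters. Antisymmetry gives the factor -1, and the flip of a letter
   bracket is the letter bracket with the roles of the letters exchanged. *)
have zb i j : (i < j < N)%N -> db (y (w (N - i.+1))) (y (w (N - j.+1)))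
    = (-1) *: letter_bracket E (@otimes k A A) (alt v2 i) (alt v2 j)
        (y (w (N - i.+1))) (y (w (N - j.+1))) (j == i.+1)%:R.
  move=> /andP[ij jN]; have iN := ltn_trans ij jN.
  have lt : (pos (w (N - j.+1)) < pos (w (N - i.+1)))%N.
    by rewrite !wK ?rN //; lia.
  rewrite scaleN1r (dbC dbP) (db_lt lt).
  rewrite (flip_letter_bracket E (@flip_linear k A) (@flip_tens k A)).
  rewrite (srcE i iN) (srcE j jN) (wK (rN i iN)) (wK (rN j jN)).
  have -> : (N - i.+1 == (N - j.+1).+1)%N = (j == i.+1) by apply/eqP/eqP; lia.
  by [].
have qN : (N - (pos q).+1 < N)%N by exact: rN.
have := continuant_moment bc E_orth h2 zl zd zb N_even qN.
have -> : (N - (N - (pos q).+1).+1)%N = pos q.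
  by rewrite -subSn // subSS subKn // ltnW.
by rewrite posK -cont1 ov => ->.
Qed.

Lemma moment_map_presented :
  multiplicative_moment_map E db (iota (pc v2) + inv v1).
Proof.
have [L2 M2] := moment_continuant2; have M1 := moment_continuant1_inv.
have ov : rev_ord v1 = v2 by apply: val_inj.
have L1 : loop E v1 (inv v1) by exact: (pres_inv pr).
have K1 : loop E v1 (iota (pc v1)).
  by rewrite /loop -!(pres_iotaM pr) -(pres_cont pr).
have K2 : loop E v2 (inv v2) by exact: (pres_inv pr).
have R1 := loopE E_orth L1; have R2 := loopE E_orth L2.
have S1 := loopE E_orth K1; have S2 := loopE E_orth K2.
have orth s t x x' : s != t -> loop E s x -> loop E t x' -> x * x' = 0.
  move=> st Lx Lx'; rewrite Lx Lx' !mulrA -(mulrA _ (E s) (E t)).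
  by rewrite (pres_idem pr) (negPf st) mulr0 !mul0r.
split.
  (* The two summands are loops at different vertices, so the inverse is formed vertex by vertex. At
     [v1], where the summand is itself an inverse, it is the continuant again. *)
  exists (inv v2 + iota (pc v1)); have E1 : E v1 + E v2 = 1.
    by have [_ <-] := E_orth; rewrite (sum2 _ v1) ov.
  rewrite !mulrDl !mulrDr (pres_invr pr) (pres_invl pr) (pres_invl pr) (pres_invr
      pr).
  rewrite (orth _ _ _ _ _ L2 K1) // (orth _ _ _ _ _ L1 K2) //.
  rewrite (orth _ _ _ _ _ K2 L1) // (orth _ _ _ _ _ K1 L2) //.
  by rewrite !(addr0, add0r) addrC E1.
exists (fun s => if s == v1 then inv v1 else iota (pc v2)); split=> [|s|a s].
- by rewrite (sum2 _ v1) ov eqxx addrC.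
- by have [->|->] := other_or v1 s; rewrite ?ov;
    [exists (inv v1) | exists (iota (pc v2))].
- have [->|->] := other_or v1 s; rewrite ?ov /=.
    by move: (M1 a); rewrite scale1r /moment_form otimes.unlock.
  by move: (M2 a); rewrite scale1r /moment_form otimes.unlock.
Qed.

End HamiltonianStructure.

(** * The algebra B(Gamma_n) *)

Section ArrowOrder.
Variable n : nat.

Definition arrow_pos (q : arrow n) : nat :=
  match q with inl i => i.*2 | inr i => i.*2.+1 end.

Lemma map_arrow_pos : map arrow_pos (Gamma_word n) = iota 0 n.*2.
Proof.
rewrite /Gamma_word map_flatten -map_comp.
rewrite (eq_map (g := (fun x => [:: x.*2;
    x.*2.+1]) \o val)) // map_comp val_enum_ord.
suff H m x : flatten [seq [:: i.*2; i.*2.+1] | i <- iota x m] = iota x.*2 m.*2.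
  exact: (H n 0%N).
by elim: m x => //= m IH x; rewrite IH.
Qed.

Lemma size_Gamma_word : size (Gamma_word n) = n.*2.
Proof. by rewrite -(size_map arrow_pos) map_arrow_pos size_iota. Qed.

Lemma arrow_pos_lt q : (arrow_pos q < n.*2)%N.
Proof. by case: q => i /=; have := ltn_ord i; lia. Qed.

Lemma arrow_pos_inj : injective arrow_pos.
Proof.
move=> [i|i] [j|j] /= H.
- by congr inl; apply: val_inj; apply: double_inj.
- by move/(congr1 odd): H; rewrite /= !odd_double.
- by move/(congr1 odd): H; rewrite /= !odd_double.
- by congr inr; apply: val_inj; apply: double_inj; case: H.
Qed.

Variable q0 : arrow n.

Lemma nth_pos j : (j < n.*2)%N -> arrow_pos (nth q0 (Gamma_word n) j) = j.
Proof.
move=> jn; rewrite -(nth_map q0 0%N) ?size_Gamma_word // map_arrow_pos.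
by rewrite nth_iota.
Qed.

Lemma pos_nth q : nth q0 (Gamma_word n) (arrow_pos q) = q.
Proof. by apply: arrow_pos_inj; rewrite nth_pos // arrow_pos_lt. Qed.

Lemma arrow_src_pos q : arrow_src q = alt v1 (arrow_pos q).
Proof. by case: q => i; rewrite /alt /= odd_double //=; apply: val_inj. Qed.

Lemma arrow_tgt_src (q : arrow n) : arrow_tgt q = rev_ord (arrow_src q).
Proof. by case: q => i; apply: val_inj. Qed.

End ArrowOrder.

(** * The two recursions for continuants *)

Section ContinuantRecursion.
Variables (k : fieldType) (P : algType k) (Q : Type) (E : 'I_2 -> P) (y : Q -> P).
Variables (src tgt : Q -> 'I_2) (rc : seq Q -> P).
Hypothesis E_orth : orthogonal_idempotents E.
Hypothesis y_letter : forall q, letter E (src q) (y q).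
Hypothesis tgt_src : forall q, tgt q = rev_ord (src q).
Hypothesis rc1 : forall q, rc [:: q] = y q.
Hypothesis rc2 : forall q p, rc [:: q; p] = E (tgt p) + y p * y q.
Hypothesis rc3 : forall q p r w,
  rc [:: q, p, r & w] = rc [:: p, r & w] * y q + rc (r :: w).

(** The recursions differ in their initial values: [rc] starts with one and two letters,
    [rec_continuant] with the empty prefix. A first letter [z 0] satisfies
    [E (rev_ord s) * z 0 = z 0], and this reconciles them. *)
Lemma continuantE (q0 : Q) (s : 'I_2) (w : seq Q) : (0 < size w)%N ->
  (forall j, (j < size w)%N -> src (nth q0 w j) = alt s j) ->
  rc (rev w) = (rec_continuant E s (fun j => y (nth q0 w j)) (size w)).1.
Proof.
move=> w0 ws; set z := fun j => _.
have z0 : E (rev_ord s) * z 0%N = z 0%N.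
  by have := letterE E_orth (y_letter (nth q0 w 0)); rewrite ws // => ->.
have revS j : (j < size w)%N -> rev (take j.+1 w) = nth q0 w j :: rev (take j w).
  by move=> jw; rewrite (take_nth q0) // rev_rcons.
have H1 : rc (rev (take 1 w)) = (rec_continuant E s z 1).1.
  by rewrite revS // take0 /= rc1 z0 addr0.
suff H j : (j.+1 < size w)%N -> rc (rev (take j.+1 w)) = (rec_continuant E s z
    j.+1).1 /\
    rc (rev (take j.+2 w)) = (rec_continuant E s z j.+2).1.
  rewrite -[in LHS](take_size w); case: (size w) w0 H => // -[|m] _ H //.
  by case: (H m).
elim: j => [|j IH] jw.
  split=> //; rewrite !revS ?(ltnW jw) // take0 /= rc2 z0 addr0.
  by rewrite addrC tgt_src ws ?(ltnW jw).
have [K1 K2] := IH (ltnW jw); split=> //.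
rewrite !revS ?(ltnW jw) ?(ltnW (ltnW jw)) // rc3.
rewrite -!revS ?(ltnW jw) ?(ltnW (ltnW jw)) //.
by rewrite K2 K1.
Qed.

End ContinuantRecursion.

Lemma alt_rev N j : ~~ odd N -> (j < N)%N -> alt v1 (N - j.+1) = alt v2 j.
Proof.
move=> N_even jN; rewrite /alt oddB // (negPf N_even) /=.
by case: (odd j); apply: val_inj.
Qed.

Lemma continuant_morphism (k : fieldType) (P A : algType k) (F : P -> A) (E :
    'I_2 -> P)
    (s : 'I_2) (z : nat -> P) j : alg_morphism F ->
  F (rec_continuant E s z j).1 = (rec_continuant (fun t => F (E t)) s (fun i => F
      (z i)) j).1 /\
  F (rec_continuant E s z j).2 = (rec_continuant (fun t => F (E t)) s (fun i => F
      (z i)) j).2.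
Proof.
move=> FA; have [F0 FD _] := alg_morphism_facts FA; have [_ FM _] := FA.
by elim: j => [|j [IH1 IH2]] //=; rewrite FD FM IH1 IH2.
Qed.

Lemma continuant_ext (k : fieldType) (A : algType k) (E : 'I_2 -> A) (s : 'I_2)
    (z z' : nat -> A) m : (forall j, (j < m)%N -> z j = z' j) ->
  rec_continuant E s z m = rec_continuant E s z' m.
Proof.
elim: m => //= m IH zz; rewrite zz // IH // => j jm.
by rewrite zz // ltnW.
Qed.

Section BGammaPresentation.
Variables (k : fieldType) (n : nat).
Hypothesis n_gt0 : (0 < n)%N.
Local Notation N := n.*2.
Local Notation wd := (Gamma_word n).
Local Notation arr := (@Gamma_arrow k n).
Local Notation idem := (@Gamma_idem k n).

Let q0 : arrow n := inl (Ordinal n_gt0).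

Lemma Gamma_letter q : letter idem (arrow_src q) (arr q).
Proof. by rewrite /letter -arrow_tgt_src; exact: Gamma_arrow_typed. Qed.

Let N_even : ~~ odd N. Proof. by rewrite odd_double. Qed.
Let N_gt0 : (0 < N)%N. Proof. by rewrite double_gt0. Qed.

Let kontE := @continuantE k _ (arrow n) idem arr (@arrow_src n) (@arrow_tgt n)
  (@rev_continuant k n) (Gamma_idem_orth k n) Gamma_letter (@arrow_tgt_src n)
  (fun q => erefl) (fun q p => erefl) (fun q p r w => erefl) q0.

Lemma word_src j : (j < N)%N -> arrow_src (nth q0 wd j) = alt v1 j.
Proof. by move=> jN; rewrite arrow_src_pos nth_pos. Qed.

Lemma word_src_rev j : (j < N)%N -> arrow_src (nth q0 wd (N - j.+1)) = alt v2 j.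
Proof.
by move=> jN; rewrite word_src ?alt_rev // ltn_subrL N_gt0.
Qed.

Lemma Gamma_continuant2 :
  Gamma_continuant k n v2 = (rec_continuant idem v1 (fun j => arr (nth q0 wd j))
      N).1.
Proof.
rewrite -(size_Gamma_word n); apply: kontE; rewrite size_Gamma_word //.
exact: word_src.
Qed.

Lemma Gamma_continuant1 : Gamma_continuant k n v1
  = (rec_continuant idem v2 (fun j => arr (nth q0 wd (N - j.+1))) N).1.
Proof.
have nthE j : (j < N)%N -> nth q0 (rev wd) j = nth q0 wd (N - j.+1).
  by move=> jN; rewrite nth_rev size_Gamma_word.
have nE j : (j < N)%N -> arr (nth q0 (rev wd) j) = arr (nth q0 wd (N - j.+1)).
  by move=> jN; rewrite nthE.
have -> : Gamma_continuant k n v1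
    = (rec_continuant idem v2 (fun j => arr (nth q0 (rev wd) j)) N).1.
  rewrite -(size_Gamma_word n) -(size_rev wd); apply: kontE;
    rewrite size_rev size_Gamma_word // => j jN.
  by rewrite nthE // word_src_rev.
by rewrite (continuant_ext _ _ nE).
Qed.

Lemma Gamma_continuant_typed s : Gamma_continuant k n s
  = idem s * Gamma_continuant k n s * idem s.
Proof.
have [->|->] := other_or v1 s.
  rewrite Gamma_continuant1.
  have zl j : (j < N)%N -> letter idem (alt v2 j) (arr (nth q0 wd (N - j.+1))).
    by move=> jN; rewrite -word_src_rev //; exact: Gamma_letter.
  have [L _] := continuant_type (Gamma_idem_orth k n) zl (leqnn N).
  rewrite (negPf N_even) /ctype /loop in L.
  have E1 : rev_ord v2 = v1 by apply: val_inj.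
  rewrite E1 in L; exact: L.
have -> : rev_ord v1 = v2 by apply: val_inj.
rewrite Gamma_continuant2.
have zl j : (j < N)%N -> letter idem (alt v1 j) (arr (nth q0 wd j)).
  by move=> jN; rewrite -word_src //; exact: Gamma_letter.
have [L _] := continuant_type (Gamma_idem_orth k n) zl (leqnn N).
rewrite (negPf N_even) /ctype /loop in L.
have E2 : rev_ord v1 = v2 by apply: val_inj.
rewrite E2 in L; exact: L.
Qed.

Lemma BGamma_presentation : presentation (@arrow_src n) (@arrow_tgt n) idem arr
  (@Gamma_continuant k n) (@BGamma_of_path k n) (@BGamma_inv k n).
Proof.
split.
- exact: Gamma_path_ind.
- exact: Gamma_path_hom.
- exact: Gamma_idem_orth.
- exact: Gamma_arrow_typed.
- exact: Gamma_continuant_typed.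
- exact: BGamma_of_path_morphism.
- exact: BGamma_ind.
- exact: BGamma_hom.
- exact: BGamma_inv_typed.
- exact: BGamma_invr.
- exact: BGamma_invl.
Qed.

Lemma BGamma_continuant2 : BGamma_of_path (Gamma_continuant k n v2)
  = (rec_continuant (fun s => BGamma_of_path (idem s)) v1
       (fun j => BGamma_of_path (arr (nth q0 wd j))) N).1.
Proof.
by rewrite Gamma_continuant2; have [] := continuant_morphism idem v1
  (fun j => arr (nth q0 wd j)) N (BGamma_of_path_morphism k n).
Qed.

Lemma BGamma_continuant1 : BGamma_of_path (Gamma_continuant k n v1)
  = (rec_continuant (fun s => BGamma_of_path (idem s)) v2
       (fun j => BGamma_of_path (arr (nth q0 wd (N - j.+1)))) N).1.
Proof.
by rewrite Gamma_continuant1; have [] := continuant_morphism idem v2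
  (fun j => arr (nth q0 wd (N - j.+1))) N (BGamma_of_path_morphism k n).
Qed.

End BGammaPresentation.

(** * Agreement with the prescribed table of values *)

Section BracketValues.
Variables (k : fieldType) (n : nat) (P A : algType k).
Variables (pe : 'I_2 -> P) (py : arrow n -> P) (iota : P -> A).
Local Notation e s := (iota (pe s)).
Local Notation a_ i := (iota (py (inl i))).
Local Notation b_ i := (iota (py (inr i))).
Local Notation br := (arrow_bracket (@arrow_src n) pe py iota (@arrow_pos n)).
Let h : k := 2^-1.

Lemma arrow_bracket_aa i j : br (inl i) (inl j) =
  if (i < j)%N then - (h *: (a_ i \ox a_ j + a_ j \ox a_ i))
  else if i == j then 0
  else h *: (a_ i \ox a_ j + a_ j \ox a_ i).
Proof.
rewrite /arrow_bracket /= !ltn_double /letter_bracket eqxx -/h -(inj_eq val_inj).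
case: (ltngtP i j) => _ //=.
  by lincomb k (tensor A A).
by lincomb k (tensor A A).
Qed.

Lemma arrow_bracket_bb i j : br (inr i) (inr j) =
  if (i < j)%N then - (h *: (b_ i \ox b_ j + b_ j \ox b_ i))
  else if i == j then 0
  else h *: (b_ i \ox b_ j + b_ j \ox b_ i).
Proof.
rewrite /arrow_bracket /= !ltnS !ltn_double /letter_bracket eqxx -/h -(inj_eq
    val_inj).
case: (ltngtP i j) => _ //=.
  by lincomb k (tensor A A).
by lincomb k (tensor A A).
Qed.

(** With [a_i] at position [2 i] and [b_j] at position [2 j + 1], the neighbours in the word are
    [a_i], [b_i] and [b_j], [a_(j+1)]. This explains the constants at [i = j] and at [i = j + 1].
    The cases [i < j] and [i = j] both belong to the branch in which [a_i] precedes [b_j]. *)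
Lemma arrow_bracket_ab i j : br (inl i) (inr j) =
  if (i < j)%N then h *: (e v1 \ox (a_ i * b_ j) + (b_ j * a_ i) \ox e v2)
  else if i == j then
    h *: ((b_ i * a_ i) \ox e v2 + e v1 \ox (a_ i * b_ i)) + e v1 \ox e v2
  else - (h *: ((b_ j * a_ i) \ox e v2 + e v1 \ox (a_ i * b_ j)))
       - (if i == j.+1 :> nat then e v1 \ox e v2 else 0).
Proof.
have E12 : (v1 == v2) = false by [].
rewrite /arrow_bracket /= /letter_bracket E12 -/h.
have -> : (j.*2.+1 == i.*2.+1) = (i == j :> nat) by apply/eqP/eqP; lia.
have -> : (i.*2 == j.*2.+2) = (i == j.+1 :> nat) by apply/eqP/eqP; lia.
have -> : (i.*2 < j.*2.+1)%N = (i <= j)%N by apply/idP/idP; lia.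
have -> : (j.*2.+1 < i.*2)%N = (j < i)%N by apply/idP/idP; lia.
rewrite -(inj_eq val_inj) /=.
case: (ltngtP i j) => [ij|ij|/val_inj->] //=.
- by lincomb k (tensor A A).
- by case: (i == j.+1 :> nat) => /=; lincomb k (tensor A A).
- by lincomb k (tensor A A).
Qed.

Lemma arrow_bracket_ba i j : br (inr i) (inl j) =
  if (i < j)%N then h *: (e v2 \ox (b_ i * a_ j) + (a_ j * b_ i) \ox e v1)
     + (if j == i.+1 :> nat then e v2 \ox e v1 else 0)
  else if i == j then
    - (h *: (e v2 \ox (b_ i * a_ i) + (a_ i * b_ i) \ox e v1)) - e v2 \ox e v1
  else - (h *: ((a_ j * b_ i) \ox e v1 + e v2 \ox (b_ i * a_ j))).
Proof.
have E21 : (v2 == v1) = false by [].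
rewrite /arrow_bracket /= /letter_bracket E21 -/h.
have -> : (i.*2.+1 == j.*2.+1) = (i == j :> nat) by apply/eqP/eqP; lia.
have -> : (j.*2 == i.*2.+2) = (j == i.+1 :> nat) by apply/eqP/eqP; lia.
have -> : (i.*2.+1 < j.*2)%N = (i < j)%N by apply/idP/idP; lia.
have -> : (j.*2 < i.*2.+1)%N = (j <= i)%N by apply/idP/idP; lia.
rewrite -(inj_eq val_inj) /=.
case: (ltngtP i j) => [ij|ij|/val_inj->] //=.
- by case: (j == i.+1 :> nat) => /=; lincomb k (tensor A A).
- by lincomb k (tensor A A).
- by lincomb k (tensor A A).
Qed.

End BracketValues.

Theorem theorem3p4 (k : fieldType) (k_char0 : [pchar k] =i pred0)
    (n : nat) (n_ge1 : (1 <= n)%N) :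
  exists db : BGamma k n -> BGamma k n -> tensor (BGamma k n) (BGamma k n),
    [/\ double_bracket (@BGamma_idem k n) db,
        BGamma_bracket_values db,
        forall db', double_bracket (@BGamma_idem k n) db' ->
          BGamma_bracket_values db' -> forall x y, db' x y = db x y
      & Hamiltonian_double_quasi_Poisson (@BGamma_idem k n) db
          (BGamma_Phi k n)].
Proof.
have h2 : 2^-1 + 2^-1 = 1 :> k.
  have two0 : 2 != 0 :> k by rewrite ((pcharf0P k).1 k_char0).
  by rewrite -mulr2n -[LHS]mulr_natr mulVf.
have pr := BGamma_presentation k n_ge1.
pose q0 : arrow n := inl (Ordinal n_ge1).
have N_even : ~~ odd n.*2 by rewrite odd_double.
pose br := arrow_bracket (@arrow_src n) (@Gamma_idem k n) (@Gamma_arrow k n)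
  (@BGamma_of_path k n) (@arrow_pos n).
pose y (q : arrow n) := BGamma_of_path (Gamma_arrow k q).
(* The table by kinds and indices of the arrows and the formula by positions in the word are the
   same data. *)
have valuesP (db : BGamma k n -> BGamma k n -> tensor (BGamma k n) (BGamma k n)) :
    BGamma_bracket_values db <-> forall p q, db (y p) (y q) = br p q.
  pose idem := @Gamma_idem k n; pose arr := @Gamma_arrow k n.
  pose io := @BGamma_of_path k n.
  have aa i j := arrow_bracket_aa idem arr io i j.
  have bb i j := arrow_bracket_bb idem arr io i j.
  have ab i j := arrow_bracket_ab idem arr io i j.
  have ba i j := arrow_bracket_ba idem arr io i j.
  rewrite otimes.unlock in aa bb ab ba.
  split=> [V [i|i] [j|j]|dbE i j].
  - by have [H _ _ _] := V i j; exact: etrans H (esym (aa i j)).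
  - by have [_ _ H _] := V i j; exact: etrans H (esym (ab i j)).
  - have [_ _ _ H] := V i j; rewrite /y H; exact: esym (ba i j).
  - by have [_ H _ _] := V i j; exact: etrans H (esym (bb i j)).
  split.
  - exact: etrans (dbE (inl i) (inl j)) (aa i j).
  - exact: etrans (dbE (inr i) (inr j)) (bb i j).
  - exact: etrans (dbE (inl i) (inr j)) (ab i j).
  - exact: etrans (dbE (inr i) (inl j)) (ba i j).
have [db [dbP dbE]] := bracket_exists pr (arrow_bracketC _ _ _ _ _)
  (arrow_bracket_typed pr (@arrow_pos n) (@arrow_tgt_src n)).
exists db; split.
- by apply/double_bracketP.
- exact/valuesP.
- move=> db' /double_bracketP db'P /valuesP db'E x z.
  by apply: (bracket_unique pr db'P dbP) => p q; rewrite db'E dbE.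
split.
- exact: BGamma_idem_orth.
- exact/double_bracketP.
- exact: (quasi_Poisson_presented pr (@pos_nth n q0) (@arrow_tgt_src n)
    dbP dbE).
- exact: (moment_map_presented pr h2 N_even (@arrow_pos_lt n) (@pos_nth n q0)
    (@nth_pos n q0) (@arrow_src_pos n) (@arrow_tgt_src n)
    (BGamma_continuant2 k n_ge1) (BGamma_continuant1 k n_ge1) dbP dbE).
Qed.
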